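(* Let $\mathbb K$ be an algebraically closed field of characteristic $0$, let $r\ge1$, and let $D$ be a semisimple closed $\Lambda_r$-Frobenius algebra in $\operatorname{Vect}_{\mathbb K}$ or in $\operatorname{SVect}_{\mathbb K}$. Then the torus invariants $\beta_d^D$, $d\mid r$, take at most two distinct values.
   Context: $\operatorname{SVect}_{\mathbb K}$ is the category of $\mathbb Z/2$-graded vector spaces and even linear maps, with braiding $v\otimes w\mapsto(-1)^{|v||w|}w\otimes v$. **Closed $\Lambda_r$-Frobenius algebras.** Let $\mathcal C$ be symmetric monoidal with braiding $\sigma$. A closed $\Lambda_r$-Frobenius algebra in $\mathcal C$ consists of objects $C_a$ ($a\in\mathbb Z/r$) and morphisms $\mu_{a,b}\colon C_a\otimes C_b\to C_{a+b-1}$, $\eta_1\colon\mathbf 1\to C_1$, $\Delta_{a,b}\colon C_{a+b+1}\to C_a\otimes C_b$, $\varepsilon_{-1}\colon C_{-1}\to\mathbf 1$. Put $\delta_a=\Delta_{a,-a}\circ\eta_1$ and $N_a=(\varepsilon_{-1}\circ\mu_{-a,a}\otimes 1_{C_a})\circ(1_{C_{-a}}\otimes\sigma_{C_a,C_a})\circ(\delta_{-a}\otimes 1_{C_a})\colon C_a\to C_a$. The axioms (for all $a,b,c,d\in\mathbb Z/r$) are: associativity $\mu_{a+b-1,c}(\mu_{a,b}\otimes1)=\mu_{a,b+c-1}(1\otimes\mu_{b,c})$; coassociativity $(\Delta_{a,b}\otimes1)\Delta_{a+b+1,c}=(1\otimes\Delta_{b,c})\Delta_{a,b+c+1}$; unitality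 $\mu_{1,a}(\eta_1\otimes1)=1=\mu_{a,1}(1\otimes\eta_1)$; counitality $(\varepsilon_{-1}\otimes1)\Delta_{-1,a}=1=(1\otimes\varepsilon_{-1})\Delta_{a,-1}$; Frobenius relation, for $a+b=c+d+2$: $(1\otimes\mu_{d-b+1,b})(\Delta_{c,a-c-1}\otimes1)=(\mu_{a,c-a+1}\otimes1)(1\otimes\Delta_{b-d-1,d})$; commutativity $\mu_{b,a}(N_b^{1-a}\otimes1)=\mu_{a,b}\circ\sigma_{C_b,C_a}=\mu_{b,a}(1\otimes N_a^{b-1})$; twist relations $N_a^a=1$ and $\mu_{a,-a}(N_a^b\otimes1)\delta_a=\mu_{a+b-1,-a-b+1}(N_{a+b-1}^b\otimes1)\delta_{a+b-1}$; and $N_a^r=1$. $D=\bigoplus_{a}D_a$ is called semisimple if it is semisimple as an algebra with product $\mu=\sum_{a,b}\mu_{a,b}$ and unit $\eta_1$. **Torus invariants.** For $d\mid r$, $\beta_d^D$ is the value of the corresponding $r$-spin TQFT on the $r$-spin torus $T(d)$, where $T(d)$, $d\mid r$, represent the diffeomorphism classes of $r$-spin tori. Algebraically, $\beta_d^D=\dim(D_d)$ is the categorical dimension of $D_d$ ($d$ taken mod $r$): the dimension in $\operatorname{Vect}_{\mathbb K}$ and the superdimension in $\operatorname{SVect}_{\mathbb K}$. *)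

(* Defs.v *)
From HB Require Import structures.
From mathcomp Require Import all_boot all_order all_algebra.
From mathcomp Require Import boolp classical_sets.

Set Implicit Arguments.
Unset Strict Implicit.
Unset Printing Implicit Defensive.

Import GRing.Theory.

Local Open Scope ring_scope.

Reserved Notation "g ∘ f" (at level 45, left associativity).
Reserved Notation "X ⊗ Y" (at level 40, left associativity).
Reserved Notation "f ⊠ g" (at level 40, left associativity).

Declare Scope smc_scope.
Delimit Scope smc_scope with smc.

(* asc, lun, run and brd are the associator, the left and right unitors and the
   braiding; ascV, lunV and runV are the inverses of the first three. *)
Record smData := SMData {
  ob :> Type;
  hom : ob -> ob -> Type;
  idh : forall X, hom X X;
  cmp : forall X Y Z, hom Y Z -> hom X Y -> hom X Z;
  ten : ob -> ob -> ob;
  tenh : forall X Y X' Y',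
    hom X X' -> hom Y Y' -> hom (ten X Y) (ten X' Y');
  uni : ob;
  asc : forall X Y Z, hom (ten (ten X Y) Z) (ten X (ten Y Z));
  ascV : forall X Y Z, hom (ten X (ten Y Z)) (ten (ten X Y) Z);
  lun : forall X, hom (ten uni X) X;
  lunV : forall X, hom X (ten uni X);
  run : forall X, hom (ten X uni) X;
  runV : forall X, hom X (ten X uni);
  brd : forall X Y, hom (ten X Y) (ten Y X)
}.

Arguments idh {s} X.
Arguments cmp {s X Y Z} g f.
Arguments ten {s} X Y.
Arguments tenh {s X Y X' Y'} f g.
Arguments uni {s}.
Arguments asc {s} X Y Z.
Arguments ascV {s} X Y Z.
Arguments lun {s} X.
Arguments lunV {s} X.
Arguments run {s} X.
Arguments runV {s} X.
Arguments brd {s} X Y.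

Notation "g ∘ f" := (cmp g f) : smc_scope.
Notation "X ⊗ Y" := (ten X Y) : smc_scope.
Notation "f ⊠ g" := (tenh f g) : smc_scope.

Section Laws.
Local Open Scope smc_scope.

Record smAxioms (C : smData) : Prop := SMAxioms {
  cmp1h : forall (X Y : C) (f : hom X Y), idh Y ∘ f = f;
  cmph1 : forall (X Y : C) (f : hom X Y), f ∘ idh X = f;
  cmpA : forall (X Y Z T : C) (h : hom Z T) (g : hom Y Z) (f : hom X Y),
    h ∘ (g ∘ f) = (h ∘ g) ∘ f;
  tenh1 : forall X Y : C, idh X ⊠ idh Y = idh (X ⊗ Y);
  tenhM : forall (X Y Z X' Y' Z' : C) (g : hom Y Z) (f : hom X Y)
      (g' : hom Y' Z') (f' : hom X' Y'),
    (g ∘ f) ⊠ (g' ∘ f') = (g ⊠ g') ∘ (f ⊠ f');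
  ascK : forall X Y Z : C, ascV X Y Z ∘ asc X Y Z = idh _;
  ascVK : forall X Y Z : C, asc X Y Z ∘ ascV X Y Z = idh _;
  lunK : forall X : C, lunV X ∘ lun X = idh _;
  lunVK : forall X : C, lun X ∘ lunV X = idh _;
  runK : forall X : C, runV X ∘ run X = idh _;
  runVK : forall X : C, run X ∘ runV X = idh _;
  asc_nat : forall (X Y Z X' Y' Z' : C)
      (f : hom X X') (g : hom Y Y') (h : hom Z Z'),
    asc X' Y' Z' ∘ ((f ⊠ g) ⊠ h) = (f ⊠ (g ⊠ h)) ∘ asc X Y Z;
  lun_nat : forall (X Y : C) (f : hom X Y),
    lun Y ∘ (idh uni ⊠ f) = f ∘ lun X;
  run_nat : forall (X Y : C) (f : hom X Y),
    run Y ∘ (f ⊠ idh uni) = f ∘ run X;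
  brd_nat : forall (X Y X' Y' : C) (f : hom X X') (g : hom Y Y'),
    brd X' Y' ∘ (f ⊠ g) = (g ⊠ f) ∘ brd X Y;
  triangle : forall X Y : C,
    (idh X ⊠ lun Y) ∘ asc X uni Y = run X ⊠ idh Y;
  pentagon : forall X Y Z T : C,
    asc X Y (Z ⊗ T) ∘ asc (X ⊗ Y) Z T
    = (idh X ⊠ asc Y Z T) ∘ asc X (Y ⊗ Z) T ∘ (asc X Y Z ⊠ idh T);
  hexagon : forall X Y Z : C,
    asc Y Z X ∘ brd X (Y ⊗ Z) ∘ asc X Y Z
    = (idh Y ⊠ brd X Z) ∘ asc Y X Z ∘ (brd X Y ⊠ idh Z);
  brdK : forall X Y : C, brd Y X ∘ brd X Y = idh (X ⊗ Y)
}.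

End Laws.

Record smCat := SMCat {
  smc_data :> smData;
  smc_axioms : smAxioms smc_data
}.

(* Z/r for r >= 1; unlike 'Z_r, this has one element when r = 1. *)
Notation Zmod r := 'I_r.-1.+1.

Definition one_mod (r : nat) : Zmod r := inZp 1.
Notation o1 := (@one_mod _).

Record frobData (C : smCat) (r : nat) := FrobData {
  fob :> Zmod r -> C;
  mu : forall a b, hom (fob a ⊗ fob b)%smc (fob (a + b - o1));
  eta : hom uni (fob o1);
  Del : forall a b, hom (fob (a + b + o1)) (fob a ⊗ fob b)%smc;
  eps : hom (fob (- o1)) uni
}.

Section Frobenius.
Local Open Scope smc_scope.
Variables (C : smCat) (r : nat) (D : frobData C r).

Definition tr (a b : Zmod r) (e : a = b) : hom (D a) (D b) :=
  ecast x (hom (D a) (D x)) e (idh (D a)).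

(* mu_{a,b} and Delta_{a,b} with the index a + b -/+ 1 replaced by an index c
   equal to it in Z/r. *)
Definition mu_to (a b c : Zmod r) (e : (a + b - o1)%R = c) :
  hom (D a ⊗ D b) (D c) := tr e ∘ mu D a b.

Definition Del_from (a b c : Zmod r) (e : (a + b + o1)%R = c) :
  hom (D c) (D a ⊗ D b) := Del D a b ∘ tr (esym e).

Lemma idx_pair (a b : Zmod r) : (a + b = 0 -> a + b - o1 = - o1)%R.
Proof. by move=> ->; rewrite sub0r. Qed.

Lemma idx_delta (a b : Zmod r) : (a + b = 0 -> a + b + o1 = o1)%R.
Proof. by move=> ->; rewrite add0r. Qed.

(* For b = - a: mu_{a,-a} : D_a ⊗ D_{-a} -> D_{-1}
   and delta_a : 1 -> D_a ⊗ D_{-a}. *)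
Definition mu_pair (a b : Zmod r) (e : (a + b)%R = 0%R) :
  hom (D a ⊗ D b) (D (- o1)%R) := mu_to (idx_pair e).

Definition delta (a b : Zmod r) (e : (a + b)%R = 0%R) :
  hom uni (D a ⊗ D b) := Del_from (idx_delta e) ∘ eta D.

Definition Nak (a : Zmod r) : hom (D a) (D a) :=
  lun (D a)
  ∘ ((eps D ∘ mu_pair (addNr a)) ⊠ idh (D a))
  ∘ ascV (D (- a)%R) (D a) (D a)
  ∘ (idh (D (- a)%R) ⊠ brd (D a) (D a))
  ∘ asc (D (- a)%R) (D a) (D a)
  ∘ (delta (addNr a) ⊠ idh (D a))
  ∘ lunV (D a).

(* N_a ^ k; for k : Z/r the coercion to nat picks the representative of k in
   {0, ..., r - 1}, which is immaterial as N_a ^ r = 1. *)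
Definition Nakpow (a : Zmod r) (k : nat) : hom (D a) (D a) :=
  iter k (cmp (Nak a)) (idh (D a)).

(* The letters u, v, w, x, y stand for the composite indices of the axioms;
   e.g. in the Frobenius relation x = a - c - 1 = d - b + 1 and
   y = c - a + 1 = b - d - 1, which exist iff a + b = c + d + 2. *)
Record closed_frobenius_axioms : Prop := {
  mu_assoc : forall (a b c u v w : Zmod r)
      (hu : (a + b - o1)%R = u) (hv : (b + c - o1)%R = v)
      (huc : (u + c - o1)%R = w) (hav : (a + v - o1)%R = w),
    mu_to huc ∘ (mu_to hu ⊠ idh (D c))
    = mu_to hav ∘ (idh (D a) ⊠ mu_to hv) ∘ asc (D a) (D b) (D c);
  Del_coassoc : forall (a b c u v w : Zmod r)
      (hu : (a + b + o1)%R = u) (hv : (b + c + o1)%R = v)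
      (huc : (u + c + o1)%R = w) (hav : (a + v + o1)%R = w),
    asc (D a) (D b) (D c) ∘ (Del_from hu ⊠ idh (D c)) ∘ Del_from huc
    = (idh (D a) ⊠ Del_from hv) ∘ Del_from hav;
  mu_unitl : forall (a : Zmod r) (h : (o1 + a - o1)%R = a),
    mu_to h ∘ (eta D ⊠ idh (D a)) = lun (D a);
  mu_unitr : forall (a : Zmod r) (h : (a + o1 - o1)%R = a),
    mu_to h ∘ (idh (D a) ⊠ eta D) = run (D a);
  Del_counitl : forall (a : Zmod r) (h : (- o1 + a + o1)%R = a),
    lun (D a) ∘ (eps D ⊠ idh (D a)) ∘ Del_from h = idh (D a);
  Del_counitr : forall (a : Zmod r) (h : (a + - o1 + o1)%R = a),
    run (D a) ∘ (idh (D a) ⊠ eps D) ∘ Del_from h = idh (D a);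
  mu_Del_frobenius : forall (a b c d x y : Zmod r)
      (hcx : (c + x + o1)%R = a) (hxb : (x + b - o1)%R = d)
      (hyd : (y + d + o1)%R = b) (hay : (a + y - o1)%R = c),
    (idh (D c) ⊠ mu_to hxb) ∘ asc (D c) (D x) (D b)
      ∘ (Del_from hcx ⊠ idh (D b))
    = (mu_to hay ⊠ idh (D d)) ∘ ascV (D a) (D y) (D d)
      ∘ (idh (D a) ⊠ Del_from hyd);
  mu_comml : forall (a b c : Zmod r)
      (hba : (b + a - o1)%R = c) (hab : (a + b - o1)%R = c),
    mu_to hba ∘ (Nakpow b (o1 - a)%R ⊠ idh (D a))
    = mu_to hab ∘ brd (D b) (D a);
  mu_commr : forall (a b c : Zmod r)
      (hba : (b + a - o1)%R = c) (hab : (a + b - o1)%R = c),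
    mu_to hab ∘ brd (D b) (D a)
    = mu_to hba ∘ (idh (D b) ⊠ Nakpow a (b - o1)%R);
  Nak_idx : forall a : Zmod r, Nakpow a a = idh (D a);
  Nak_twist : forall a b : Zmod r,
    mu_pair (subrr a) ∘ (Nakpow a b ⊠ idh (D (- a)%R)) ∘ delta (subrr a)
    = mu_pair (subrr (a + b - o1)%R)
      ∘ (Nakpow (a + b - o1)%R b ⊠ idh (D (- (a + b - o1))%R))
      ∘ delta (subrr (a + b - o1)%R);
  Nak_order : forall a : Zmod r, Nakpow a r = idh (D a)
}.

End Frobenius.

Record closedFrobenius (C : smCat) (r : nat) := ClosedFrobenius {
  frob_data :> frobData C r;
  frob_axioms : closed_frobenius_axioms frob_data
}.

Section Tensor.
Variables (K : fieldType) (V W : lmodType K).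

Definition formal_eval (U : lmodType K) (f : V -> W -> U) (s : seq (V * W)) :=
  \sum_(p <- s) f p.1 p.2.

(* Formal sums of pairs (v, w) are identified when no bilinear map
   distinguishes them; see [tlift], [tliftE] and [tensor_ext] for the universal
   property of the quotient. *)
Definition tensor_rel (s t : seq (V * W)) : bool :=
  `[< forall (U : lmodType K) (f : {bilinear V -> W -> U}),
        formal_eval f s = formal_eval f t >].

Lemma tensor_rel_refl : reflexive tensor_rel.
Proof. by move=> s; apply/asboolP. Qed.

Lemma tensor_rel_sym : symmetric tensor_rel.
Proof. by move=> s t; apply/asboolP/asboolP => h U f; rewrite h. Qed.

Lemma tensor_rel_trans : transitive tensor_rel.
Proof.
by move=> t s u /asboolP h1 /asboolP h2; apply/asboolP => U f; rewrite h1 h2.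
Qed.

Canonical tensor_equiv :=
  EquivRel tensor_rel tensor_rel_refl tensor_rel_sym tensor_rel_trans.

Definition tensor : Type := {eq_quot tensor_equiv}%qT.

HB.instance Definition _ := Choice.on tensor.
HB.instance Definition _ := EqQuotient.on tensor.

Local Open Scope quotient_scope.

Lemma tensor_eq (s t : seq (V * W)) :
  (forall (U : lmodType K) (f : {bilinear V -> W -> U}),
     formal_eval f s = formal_eval f t) -> \pi_tensor s = \pi_tensor t.
Proof. by move=> h; apply/eqmodP/asboolP. Qed.

Definition eval (U : lmodType K) (f : V -> W -> U) (t : tensor) : U :=
  formal_eval f (repr t).

Lemma eval_pi (U : lmodType K) (f : {bilinear V -> W -> U}) s :
  eval f (\pi_tensor s) = formal_eval f s.
Proof.
rewrite /eval; have /eqmodP/asboolP : repr (\pi_tensor s) = s %[mod tensor].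
  by rewrite reprK.
exact.
Qed.

Lemma tensor_sep (x y : tensor) :
  (forall (U : lmodType K) (f : {bilinear V -> W -> U}), eval f x = eval f y) ->
  x = y.
Proof. by move=> h; rewrite -[x]reprK -[y]reprK; apply: tensor_eq. Qed.

Definition tzero : tensor := \pi_tensor [::].
Definition tadd (x y : tensor) : tensor := \pi_tensor (repr x ++ repr y).
Definition tscale (c : K) (x : tensor) : tensor :=
  \pi_tensor [seq (c *: p.1, p.2) | p <- repr x].
Definition topp (x : tensor) : tensor := tscale (-1) x.

Lemma eval_tzero (U : lmodType K) (f : {bilinear V -> W -> U}) :
  eval f tzero = 0.
Proof. by rewrite eval_pi /formal_eval big_nil. Qed.

Lemma eval_tadd (U : lmodType K) (f : {bilinear V -> W -> U}) x y :
  eval f (tadd x y) = eval f x + eval f y.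
Proof. by rewrite eval_pi /formal_eval big_cat. Qed.

Lemma eval_tscale (U : lmodType K) (f : {bilinear V -> W -> U}) c x :
  eval f (tscale c x) = c *: eval f x.
Proof.
rewrite eval_pi /eval /formal_eval big_map scaler_sumr.
by apply: eq_bigr => p _; rewrite linearZl_LR.
Qed.

Let tevalE := (eval_tzero, eval_tadd, eval_tscale).

Fact taddA : associative tadd.
Proof. by move=> x y z; apply: tensor_sep => U f; rewrite !tevalE addrA. Qed.
Fact taddC : commutative tadd.
Proof. by move=> x y; apply: tensor_sep => U f; rewrite !tevalE addrC. Qed.
Fact tadd0 : left_id tzero tadd.
Proof. by move=> x; apply: tensor_sep => U f; rewrite !tevalE add0r. Qed.
Fact taddN : left_inverse tzero topp tadd.
Proof.
by move=> x; apply: tensor_sep => U f; rewrite !tevalE scaleN1r addNr.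
Qed.

HB.instance Definition _ := GRing.isZmodule.Build tensor taddA taddC tadd0 taddN.

Fact tscaleA a b x : tscale a (tscale b x) = tscale (a * b) x.
Proof. by apply: tensor_sep => U f; rewrite !tevalE scalerA. Qed.
Fact tscale1 : left_id 1 tscale.
Proof. by move=> x; apply: tensor_sep => U f; rewrite !tevalE scale1r. Qed.
Fact tscaleDr : right_distributive tscale +%R.
Proof.
by move=> c x y; apply: tensor_sep => U f; rewrite !tevalE scalerDr.
Qed.
Fact tscaleDl x : {morph tscale^~ x : a b / a + b}.
Proof.
by move=> a b; apply: tensor_sep => U f; rewrite !tevalE scalerDl.
Qed.

HB.instance Definition _ := GRing.Zmodule_isLmodule.Build K tensor
  tscaleA tscale1 tscaleDr tscaleDl.

Definition tpure (v : V) (w : W) : tensor := \pi_tensor [:: (v, w)].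

Lemma eval_tpure (U : lmodType K) (f : {bilinear V -> W -> U}) v w :
  eval f (tpure v w) = f v w.
Proof. by rewrite eval_pi /formal_eval big_seq1. Qed.

Fact tpure_bilinear : bilinear_for *:%R *:%R tpure.
Proof.
split=> [w c v v'|v c w w']; apply: tensor_sep => U f;
  by rewrite eval_tadd eval_tscale !eval_tpure ?linearPl ?linearPr.
Qed.

HB.instance Definition _ := bilinear_isBilinear.Build K V W tensor *:%R *:%R
  tpure tpure_bilinear.

Lemma tensor_ind (P : tensor -> Prop) :
  P 0 -> (forall x y, P x -> P y -> P (x + y)) ->
  (forall v w, P (tpure v w)) -> forall x, P x.
Proof.
move=> P0 PD Pp; elim/quotW => s.
elim: s => [|[v w] s IH]; first exact: P0.
suff -> : \pi_tensor ((v, w) :: s) = tpure v w + \pi_tensor s by exact: PD.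
apply: tensor_sep => U f; rewrite eval_tadd eval_tpure !eval_pi.
by rewrite /formal_eval big_cons.
Qed.

Section Lift.
Variables (U : lmodType K) (f : {bilinear V -> W -> U}).

Fact eval_linear : linear (eval f).
Proof. by move=> c x y; rewrite eval_tadd eval_tscale. Qed.

HB.instance Definition _ := GRing.isLinear.Build K tensor U *:%R (eval f)
  eval_linear.

Definition tlift : {linear tensor -> U} := eval f.

Lemma tliftE v w : tlift (tpure v w) = f v w.
Proof. exact: eval_tpure. Qed.

End Lift.

End Tensor.

Arguments tlift : simpl never.

Notation "V ⊗ W" := (tensor V W) : type_scope.
Notation "v ⊗ w" := (tpure v w) : ring_scope.

Section LinearMaps.
Variable K : fieldType.
Implicit Types V W U X Y : lmodType K.

Lemma linear_ext V W (f g : {linear V -> W}) : f =1 g -> f = g.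
Proof.
case: f g => [f [[hf1] [hf2] ]] [g [[hg1] [hg2] ]] /= /funext fg; subst g.
by rewrite (Prop_irrelevance hf1 hg1) (Prop_irrelevance hf2 hg2).
Qed.

Lemma tensor_ext V W U (f g : {linear tensor V W -> U}) :
  (forall v w, f (v ⊗ w) = g (v ⊗ w)) -> f = g.
Proof.
move=> fg; apply: linear_ext; apply: tensor_ind => [|x y hx hy|//].
  by rewrite !linear0.
by rewrite !linearD hx hy.
Qed.

Definition mklin V W (f : V -> W) (h : linear f) : {linear V -> W} :=
  HB.pack f (GRing.isLinear.Build K V W *:%R f h).

Definition mkbilin V W U (f : V -> W -> U) (h : bilinear_for *:%R *:%R f) :
    {bilinear V -> W -> U} :=
  HB.pack f (bilinear_isBilinear.Build K V W U *:%R *:%R f h).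

Definition lcomp V W U (g : {linear W -> U}) (f : {linear V -> W}) :
  {linear V -> U} := g \o f.

Fact tmap_bilinear V W X Y (f : {linear V -> X}) (g : {linear W -> Y}) :
  bilinear_for *:%R *:%R (fun v w => f v ⊗ g w).
Proof. by split=> [w c v v'|v c w w']; rewrite linearP ?linearPl ?linearPr. Qed.

Definition tmap V W X Y (f : {linear V -> X}) (g : {linear W -> Y}) :
  {linear tensor V W -> tensor X Y} := tlift (mkbilin (tmap_bilinear f g)).

Lemma tmapE V W X Y (f : {linear V -> X}) (g : {linear W -> Y}) v w :
  tmap f g (v ⊗ w) = f v ⊗ g w.
Proof. exact: tliftE. Qed.

Fact tassoc_bilinear1 V W U (u : U) :
  bilinear_for *:%R *:%R (fun (v : V) (w : W) => v ⊗ (w ⊗ u)).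
Proof. by split=> [w c v v'|v c w w']; rewrite ?linearPl ?linearPr. Qed.

Fact tassoc_bilinear V W U :
  bilinear_for *:%R *:%R
    (fun (x : tensor V W) (u : U) => tlift (mkbilin (tassoc_bilinear1 V W u)) x).
Proof.
split=> [u c x y|x c u u']; first by rewrite linearP.
elim/tensor_ind: x => [|x y hx hy|v w]; first by rewrite !linear0 /= scaler0 addr0.
  by rewrite !linearD hx hy /= scalerDr addrACA.
by rewrite !tliftE /= !linearPr.
Qed.

Definition tassoc V W U :
    {linear tensor (tensor V W) U -> tensor V (tensor W U)} :=
  tlift (mkbilin (tassoc_bilinear V W U)).

Lemma tassocE V W U v w u :
  tassoc V W U ((v ⊗ w) ⊗ u) = v ⊗ (w ⊗ u).
Proof. by rewrite tliftE; exact: tliftE. Qed.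

Fact tassocV_bilinear1 V W U (v : V) :
  bilinear_for *:%R *:%R (fun (w : W) (u : U) => (v ⊗ w) ⊗ u).
Proof.
by split=> [u c w w'|w c u u']; rewrite ?linearPr ?linearPl.
Qed.

Fact tassocV_bilinear V W U :
  bilinear_for *:%R *:%R
    (fun (v : V) (x : tensor W U) => tlift (mkbilin (tassocV_bilinear1 W U v)) x).
Proof.
split=> [x c v v'|v c x y]; last by rewrite linearP.
elim/tensor_ind: x => [|x y hx hy|w u]; first by rewrite !linear0 /= scaler0 addr0.
  by rewrite !linearD hx hy /= scalerDr addrACA.
by rewrite !tliftE /= !linearPl.
Qed.

Definition tassocV V W U :
    {linear tensor V (tensor W U) -> tensor (tensor V W) U} :=
  tlift (mkbilin (tassocV_bilinear V W U)).

Lemma tassocVE V W U v w u :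
  tassocV V W U (v ⊗ (w ⊗ u)) = (v ⊗ w) ⊗ u.
Proof. by rewrite tliftE; exact: tliftE. Qed.

Fact tlunit_bilinear V : bilinear_for *:%R *:%R (fun (c : K^o) (v : V) => c *: v).
Proof.
split=> [v a b c|b a v v'] /=; first by rewrite scalerA -scalerDl.
by rewrite scalerDr !scalerA mulrC.
Qed.

Definition tlunit V : {linear tensor K^o V -> V} :=
  tlift (mkbilin (@tlunit_bilinear V)).

Fact tlunitV_linear V : linear (fun v : V => @tpure K K^o V 1 v).
Proof. by move=> c v w; rewrite linearPr. Qed.

Definition tlunitV V : {linear V -> tensor K^o V} := mklin (@tlunitV_linear V).

Fact trunit_bilinear V : bilinear_for *:%R *:%R (fun (v : V) (c : K^o) => c *: v).
Proof. by split=> [c a v v'|v a b c]; [apply: (@tlunit_bilinear V).2|apply: (@tlunit_bilinear V).1]. Qed.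

Definition trunit V : {linear tensor V K^o -> V} :=
  tlift (mkbilin (@trunit_bilinear V)).

Fact trunitV_linear V : linear (fun v : V => @tpure K V K^o v 1).
Proof. by move=> c v w; rewrite linearPl. Qed.

Definition trunitV V : {linear V -> tensor V K^o} := mklin (@trunitV_linear V).

Fact tswap_bilinear V W : bilinear_for *:%R *:%R (fun (v : V) (w : W) => w ⊗ v).
Proof. by split=> [w c v v'|v c w w']; rewrite ?linearPl ?linearPr. Qed.

Definition tswap V W : {linear tensor V W -> tensor W V} :=
  tlift (mkbilin (@tswap_bilinear V W)).

Lemma tlunitE V c (v : V) : tlunit V (c ⊗ v) = c *: v.
Proof. exact: tliftE. Qed.
Lemma tlunitVE V (v : V) : tlunitV V v = @tpure K K^o V 1 v.
Proof. by []. Qed.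
Lemma trunitE V c (v : V) : trunit V (v ⊗ c) = c *: v.
Proof. exact: tliftE. Qed.
Lemma trunitVE V (v : V) : trunitV V v = @tpure K V K^o v 1.
Proof. by []. Qed.
Lemma tswapE V W (v : V) (w : W) : tswap V W (v ⊗ w) = w ⊗ v.
Proof. exact: tliftE. Qed.
Lemma lcompE V W U (g : {linear W -> U}) (f : {linear V -> W}) x :
  lcomp g f x = g (f x).
Proof. by []. Qed.

Lemma scale_unit_l V (c : K^o) (v : V) : @tpure K K^o V 1 (c *: v) = c ⊗ v.
Proof.
by rewrite linearZr_LR -linearZl_LR /=; congr (_ ⊗ _); exact: mulr1.
Qed.

Lemma scale_unit_r V (c : K^o) (v : V) : @tpure K V K^o (c *: v) 1 = v ⊗ c.
Proof.
by rewrite linearZl_LR -linearZr_LR /=; congr (_ ⊗ _); exact: mulr1.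
Qed.

Lemma tensor_ext3 V W U X (f g : {linear tensor (tensor V W) U -> X}) :
  (forall v w u, f ((v ⊗ w) ⊗ u) = g ((v ⊗ w) ⊗ u)) -> f = g.
Proof.
move=> fg; apply: tensor_ext => x u; elim/tensor_ind: x => [|x y hx hy|//].
  by rewrite linear0l !linear0.
by rewrite linearDl !linearD hx hy.
Qed.

Lemma tensor_ext3' V W U X (f g : {linear tensor V (tensor W U) -> X}) :
  (forall v w u, f (v ⊗ (w ⊗ u)) = g (v ⊗ (w ⊗ u))) -> f = g.
Proof.
move=> fg; apply: tensor_ext => v x; elim/tensor_ind: x => [|x y hx hy|//].
  by rewrite linear0r !linear0.
by rewrite linearDr !linearD hx hy.
Qed.

Lemma tensor_ext4 V W U Y X
    (f g : {linear tensor (tensor (tensor V W) U) Y -> X}) :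
  (forall v w u y, f (((v ⊗ w) ⊗ u) ⊗ y) = g (((v ⊗ w) ⊗ u) ⊗ y)) -> f = g.
Proof.
move=> fg; apply: tensor_ext3 => x u y; elim/tensor_ind: x => [|x x' hx hx'|//].
  by rewrite !linear0l !linear0.
by rewrite !linearDl !linearD hx hx'.
Qed.

Let E := (lcompE, tmapE, tassocE, tassocVE, tlunitE, tlunitVE, trunitE,
  trunitVE, tswapE).

Definition Vect_data : smData := @SMData (lmodType K)
  (fun V W => {linear V -> W}) (fun V => idfun) (fun V W U g f => lcomp g f)
  (fun V W => tensor V W) (fun V W X Y f g => tmap f g) K^o
  tassoc tassocV tlunit tlunitV trunit trunitV tswap.

Lemma Vect_axioms : smAxioms Vect_data.
Proof.
split => /=.
- by move=> V W f; apply: linear_ext.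
- by move=> V W f; apply: linear_ext.
- by move=> V W U X h g f; apply: linear_ext.
- by move=> V W; apply: tensor_ext => v w; rewrite tmapE.
- by move=> *; apply: tensor_ext => v w; rewrite !E.
- by move=> *; apply: tensor_ext3 => v w u; rewrite !E.
- by move=> *; apply: tensor_ext3' => v w u; rewrite !E.
- by move=> *; apply: tensor_ext => c v; rewrite !E scale_unit_l.
- by move=> *; apply: linear_ext => v; rewrite !E scale1r.
- by move=> *; apply: tensor_ext => v c; rewrite !E scale_unit_r.
- by move=> *; apply: linear_ext => v; rewrite !E scale1r.
- by move=> *; apply: tensor_ext3 => v w u; rewrite !E.
- by move=> *; apply: tensor_ext => c v; rewrite !E linearZ.
- by move=> *; apply: tensor_ext => v c; rewrite !E linearZ.
- by move=> *; apply: tensor_ext => v w; rewrite !E.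
- by move=> *; apply: tensor_ext3 => v c w; rewrite !E linearZl_LR linearZr_LR.
- by move=> *; apply: tensor_ext4 => v w u x; rewrite !E.
- by move=> *; apply: tensor_ext3 => v w u; rewrite !E.
- by move=> *; apply: tensor_ext => v w; rewrite !E.
Qed.

Definition Vect : smCat := SMCat Vect_axioms.

End LinearMaps.

(* A Z/2-graded vector space V = V_0 ⊕ V_1, given by its two projections, with
   the degrees 0, 1 in Z/2 represented by false, true and their sum by (+). *)
Record svect (K : fieldType) := SVectOb {
  sv_car :> lmodType K;
  sv_proj : bool -> {linear sv_car -> sv_car};
  sv_projM : forall i j x,
    sv_proj i (sv_proj j x) = if i == j then sv_proj i x else 0;
  sv_projD : forall x, sv_proj false x + sv_proj true x = x
}.

Definition homog (K : fieldType) (V : svect K) (i : bool) (x : V) : Prop :=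
  sv_proj V i x = x.

Record svhom (K : fieldType) (V W : svect K) := SVHom {
  sv_fun :> {linear V -> W};
  sv_even : forall i x, homog i x -> homog i (sv_fun x)
}.

Section SuperVect.
Variable K : fieldType.
Implicit Types V W U X Y : svect K.

Lemma svhom_ext V W (f g : svhom V W) :
  sv_fun f = sv_fun g -> f = g.
Proof.
case: f g => [f hf] [g hg] /= fg; subst g.
by rewrite (Prop_irrelevance hf hg).
Qed.

Lemma homog_proj V i (x : V) : homog i (sv_proj V i x).
Proof. by rewrite /homog sv_projM eqxx. Qed.

Lemma proj_homog V i j (x : V) :
  homog i x -> sv_proj V j x = if j == i then x else 0.
Proof.
by move=> hx; rewrite -{1}hx sv_projM; case: eqP => // ->.
Qed.

Fact svone_proj_linear (i : bool) : linear (fun c : K^o => if i then 0 else c).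
Proof. by case: i => c x y //; rewrite scaler0 addr0. Qed.

Fact svone_projM i j (x : K^o) :
  mklin (svone_proj_linear i) (mklin (svone_proj_linear j) x)
  = if i == j then mklin (svone_proj_linear i) x else 0.
Proof. by case: i; case: j. Qed.

Fact svone_projD (x : K^o) :
  mklin (svone_proj_linear false) x + mklin (svone_proj_linear true) x = x.
Proof. exact: addr0. Qed.

Definition svone : svect K := SVectOb svone_projM svone_projD.

Fact svten_proj_bilinear V W (k : bool) :
  bilinear_for *:%R *:%R
    (fun (v : V) (w : W) =>
       \sum_(i : bool) sv_proj V i v ⊗ sv_proj W (i (+) k) w).
Proof.
split=> [w c v v'|v c w w'] /=; rewrite scaler_sumr -big_split;
  by apply: eq_bigr => i _; rewrite linearP ?linearPl ?linearPr.
Qed.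

(* (V ⊗ W)_k is the sum of the V_i ⊗ W_j with i + j = k. *)
Definition svten_proj V W (k : bool) : {linear tensor V W -> tensor V W} :=
  tlift (mkbilin (@svten_proj_bilinear V W k)).

Lemma svten_projE V W k i j (v : V) (w : W) : homog i v -> homog j w ->
  svten_proj V W k (v ⊗ w) = if k == i (+) j then v ⊗ w else 0.
Proof.
move=> hv hw; rewrite tliftE /= (bigD1 i) //= big1 ?addr0.
  rewrite (proj_homog _ hv) eqxx (proj_homog _ hw).
  by case: i j k {hv hw} => [] [] [] //=; rewrite linear0r.
by move=> l li; rewrite (proj_homog _ hv) (negbTE li) linear0l.
Qed.

Lemma tpure_dec V W (v : V) (w : W) :
  v ⊗ w = (sv_proj V false v ⊗ sv_proj W false w
             + sv_proj V true v ⊗ sv_proj W true w)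
          + (sv_proj V false v ⊗ sv_proj W true w
             + sv_proj V true v ⊗ sv_proj W false w).
Proof.
rewrite -{1}[v]sv_projD -{1}[w]sv_projD linearDl !linearDr.
by rewrite [X in _ + X]addrC addrACA.
Qed.

Lemma tensor_extH V W (U : lmodType K) (f g : {linear tensor V W -> U}) :
  (forall i j v w, homog i v -> homog j w -> f (v ⊗ w) = g (v ⊗ w)) -> f = g.
Proof.
move=> fg; apply: tensor_ext => v w; rewrite tpure_dec !linearD.
by do 3?congr (_ + _); apply: fg; apply: homog_proj.
Qed.

Fact svten_projM V W i j (x : tensor V W) :
  svten_proj V W i (svten_proj V W j x)
  = if i == j then svten_proj V W i x else 0.
Proof.
elim/tensor_ind: x => [|x y hx hy|v w].
- by rewrite !linear0; case: ifP.
- by rewrite !linearD hx hy; case: ifP; rewrite ?addr0.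
have E k l m := svten_projE k (homog_proj l v) (homog_proj m w).
move: (svten_proj V W) E => p E; rewrite tpure_dec !linearD !E.
by case: i; case: j => /=;
  rewrite ?(addr0, add0r, linear0) ?linearD ?E /= ?(addr0, add0r).
Qed.

Fact svten_projD V W (x : tensor V W) :
  svten_proj V W false x + svten_proj V W true x = x.
Proof.
elim/tensor_ind: x => [|x y hx hy|v w].
- by rewrite !linear0 addr0.
- by rewrite !linearD addrACA hx hy.
have E k l m := svten_projE k (homog_proj l v) (homog_proj m w).
by rewrite [v ⊗ w]tpure_dec !linearD !E /= !(addr0, add0r).
Qed.

Definition svten V W : svect K :=
  SVectOb (@svten_projM V W) (@svten_projD V W).


Lemma homog_tpure V W i j (v : V) (w : W) :
  homog i v -> homog j w -> @homog K (svten V W) (i (+) j) (v ⊗ w).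
Proof. by move=> hv hw; rewrite /homog (svten_projE _ hv hw) eqxx. Qed.

Lemma even_of_comm V W (f : {linear V -> W}) :
  (forall k, lcomp f (sv_proj V k) = lcomp (sv_proj W k) f) ->
  forall i x, homog i x -> homog i (f x).
Proof.
move=> h i x hx; rewrite /homog.
by have := congr1 (fun g : {linear V -> W} => g x) (h i); rewrite /= hx.
Qed.

Lemma even_tensor V W U (f : {linear svten V W -> U}) :
  (forall i j v w, homog i v -> homog j w -> homog (i (+) j) (f (v ⊗ w))) ->
  forall i x, homog i x -> homog i (f x).
Proof.
move=> h; apply: even_of_comm => k; apply: tensor_extH => i j v w hv hw.
rewrite !lcompE (proj_homog _ (homog_tpure hv hw)) (proj_homog _ (h _ _ _ _ hv hw)).
by case: ifP; rewrite ?linear0.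
Qed.

Lemma tensor_extH3 V W U (X : lmodType K)
    (f g : {linear tensor (tensor V W) U -> X}) :
  (forall i j k v w u, homog i v -> homog j w -> homog k u ->
     f ((v ⊗ w) ⊗ u) = g ((v ⊗ w) ⊗ u)) -> f = g.
Proof.
move=> fg; apply: tensor_ext3 => v w u.
rewrite tpure_dec -[u]sv_projD !(linearDl, linearDr) !linearD.
by do 7?congr (_ + _); apply: fg; apply: homog_proj.
Qed.

Lemma tensor_extH3' V W U (X : lmodType K)
    (f g : {linear tensor V (tensor W U) -> X}) :
  (forall i j k v w u, homog i v -> homog j w -> homog k u ->
     f (v ⊗ (w ⊗ u)) = g (v ⊗ (w ⊗ u))) -> f = g.
Proof.
move=> fg; apply: tensor_ext3' => v w u.
rewrite [w ⊗ u]tpure_dec -[v]sv_projD !(linearDl, linearDr) !linearD.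
by do 7?congr (_ + _); apply: fg; apply: homog_proj.
Qed.

Lemma even_tensor3 V W U X (f : {linear svten (svten V W) U -> X}) :
  (forall i j k v w u, homog i v -> homog j w -> homog k u ->
     homog (i (+) j (+) k) (f ((v ⊗ w) ⊗ u))) ->
  forall i x, homog i x -> homog i (f x).
Proof.
move=> h; apply: even_of_comm => l.
apply: (@tensor_extH3 V W U) => i j k v w u hv hw hu.
rewrite !lcompE (proj_homog _ (h _ _ _ _ _ _ hv hw hu)).
rewrite (proj_homog _ (@homog_tpure (svten V W) U _ _ _ _ (homog_tpure hv hw) hu)).
by case: ifP; rewrite ?linear0.
Qed.

Lemma even_tensor3' V W U X (f : {linear svten V (svten W U) -> X}) :
  (forall i j k v w u, homog i v -> homog j w -> homog k u ->
     homog (i (+) (j (+) k)) (f (v ⊗ (w ⊗ u)))) ->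
  forall i x, homog i x -> homog i (f x).
Proof.
move=> h; apply: even_of_comm => l.
apply: (@tensor_extH3' V W U) => i j k v w u hv hw hu.
rewrite !lcompE (proj_homog _ (h _ _ _ _ _ _ hv hw hu)).
rewrite (proj_homog _ (@homog_tpure V (svten W U) _ _ _ _ hv (homog_tpure hw hu))).
by case: ifP; rewrite ?linear0.
Qed.

Lemma homogZ V i c (x : V) : homog i x -> homog i (c *: x).
Proof. by rewrite /homog linearZ /= => ->. Qed.

Lemma homog0 V i : homog i (0 : V).
Proof. exact: linear0. Qed.

Definition svid V : svhom V V := @SVHom K V V idfun (fun i x h => h).

Definition svcomp V W U (g : svhom W U) (f : svhom V W) : svhom V U :=
  @SVHom K V U (lcomp g f) (fun i x h => sv_even g (sv_even f h)).

Fact svmap_even V W X Y (f : svhom V X) (g : svhom W Y) i (x : svten V W) :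
  homog i x -> @homog K (svten X Y) i (tmap f g x).
Proof.
move: i x; apply: even_tensor => i j v w hv hw; rewrite tmapE.
by apply: homog_tpure; apply: sv_even.
Qed.

Definition svmap V W X Y (f : svhom V X) (g : svhom W Y) :
  svhom (svten V W) (svten X Y) := SVHom (svmap_even f g).

Fact svassoc_even V W U i (x : svten (svten V W) U) :
  homog i x -> @homog K (svten V (svten W U)) i (tassoc V W U x).
Proof.
move: i x; apply: even_tensor3 => i j k v w u hv hw hu; rewrite tassocE.
by rewrite -addbA; do 2?apply: (@homog_tpure _ _ _ _ _ _ _ _) => //.
Qed.

Definition svassoc V W U :
  svhom (svten (svten V W) U) (svten V (svten W U)) :=
  SVHom (@svassoc_even V W U).

Fact svassocV_even V W U i (x : svten V (svten W U)) :
  homog i x -> @homog K (svten (svten V W) U) i (tassocV V W U x).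
Proof.
move: i x; apply: even_tensor3' => i j k v w u hv hw hu; rewrite tassocVE.
by rewrite addbA; do 2?apply: (@homog_tpure _ _ _ _ _ _ _ _) => //.
Qed.

Definition svassocV V W U :
  svhom (svten V (svten W U)) (svten (svten V W) U) :=
  SVHom (@svassocV_even V W U).

Fact svlunit_even V i (x : svten svone V) :
  homog i x -> homog i (tlunit V x).
Proof.
move: i x; apply: even_tensor => i j c v hc hv; rewrite tlunitE.
by case: i hc => /= hc; [rewrite -hc scale0r; apply: homog0|apply: homogZ].
Qed.

Definition svlunit V : svhom (svten svone V) V := SVHom (@svlunit_even V).

Fact svlunitV_even V i (v : V) :
  homog i v -> @homog K (svten svone V) i (tlunitV V v).
Proof.
move=> hv; rewrite tlunitVE -[i]addFb.
by apply: (@homog_tpure svone V false i).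
Qed.

Definition svlunitV V : svhom V (svten svone V) := SVHom (@svlunitV_even V).

Fact svrunit_even V i (x : svten V svone) :
  homog i x -> homog i (trunit V x).
Proof.
move: i x; apply: even_tensor => i j v c hv hc; rewrite trunitE.
case: j hc => /= hc; first by rewrite -hc scale0r; apply: homog0.
by rewrite addbF; apply: homogZ.
Qed.

Definition svrunit V : svhom (svten V svone) V := SVHom (@svrunit_even V).

Fact svrunitV_even V i (v : V) :
  homog i v -> @homog K (svten V svone) i (trunitV V v).
Proof.
move=> hv; rewrite trunitVE -[i]addbF.
by apply: (@homog_tpure V svone i false).
Qed.

Definition svrunitV V : svhom V (svten V svone) := SVHom (@svrunitV_even V).

Fact svswap_bilinear V W :
  bilinear_for *:%R *:%R
    (fun (v : V) (w : W) => \sum_(i : bool) \sum_(j : bool)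
       (-1) ^+ (i && j) *: (sv_proj W j w ⊗ sv_proj V i v)).
Proof.
split=> [w c v v'|v c w w'] /=; rewrite scaler_sumr -big_split;
  apply: eq_bigr => i _ /=; rewrite scaler_sumr -big_split;
  apply: eq_bigr => j _ /=; rewrite linearP ?linearPl ?linearPr /=;
  by rewrite scalerDr !scalerA mulrC.
Qed.

(* v ⊗ w |-> (-1)^(|v||w|) w ⊗ v, extended bilinearly; see [svswapE]. *)
Definition svswap_fun V W : {linear tensor V W -> tensor W V} :=
  tlift (mkbilin (@svswap_bilinear V W)).

Lemma svswapE V W i j (v : V) (w : W) : homog i v -> homog j w ->
  svswap_fun V W (v ⊗ w) = (-1) ^+ (i && j) *: (w ⊗ v).
Proof.
move=> hv hw; rewrite tliftE /= (bigD1 i) //= (bigD1 j) //=.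
rewrite (proj_homog _ hv) (proj_homog _ hw) !eqxx big1 => [|l lj].
  rewrite addr0 big1 ?addr0 // => l li; rewrite big1 // => m _.
  by rewrite (proj_homog _ hv) (negbTE li) linear0r scaler0.
by rewrite (proj_homog _ hw) (negbTE lj) linear0l scaler0.
Qed.

Fact svswap_even V W i (x : svten V W) :
  homog i x -> @homog K (svten W V) i (svswap_fun V W x).
Proof.
move: i x; apply: even_tensor => i j v w hv hw; rewrite (svswapE hv hw).
by rewrite addbC; apply: homogZ; apply: homog_tpure.
Qed.

Definition svswap V W : svhom (svten V W) (svten W V) :=
  SVHom (@svswap_even V W).

Definition SVect_data : smData := @SMData (svect K) (@svhom K)
  svid svcomp svten svmap svone
  svassoc svassocV svlunit svlunitV svrunit svrunitV svswap.

Let E := (lcompE, tmapE, tassocE, tassocVE).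

Lemma SVect_axioms : smAxioms SVect_data.
Proof.
have A := Vect_axioms K; split => /=.
- by move=> V W f; apply: svhom_ext; apply: linear_ext.
- by move=> V W f; apply: svhom_ext; apply: linear_ext.
- by move=> *; apply: svhom_ext; apply: linear_ext.
- by move=> V W; apply: svhom_ext; apply: (tenh1 A).
- by move=> *; apply: svhom_ext; apply: (tenhM A).
- by move=> *; apply: svhom_ext; apply: (ascK A).
- by move=> *; apply: svhom_ext; apply: (ascVK A).
- by move=> *; apply: svhom_ext; apply: (lunK A).
- by move=> *; apply: svhom_ext; apply: (lunVK A).
- by move=> *; apply: svhom_ext; apply: (runK A).
- by move=> *; apply: svhom_ext; apply: (runVK A).
- by move=> *; apply: svhom_ext; apply: (asc_nat A).
- by move=> *; apply: svhom_ext; apply: (lun_nat A).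
- by move=> *; apply: svhom_ext; apply: (run_nat A).
- move=> V W X Y f g; apply: svhom_ext; apply: tensor_extH => i j v w hv hw.
  change (svswap_fun X Y (tmap f g (v ⊗ w)) = tmap g f (svswap_fun V W (v ⊗ w))).
  rewrite tmapE (svswapE (sv_even f hv) (sv_even g hw)).
  by rewrite (svswapE hv hw) linearZ tmapE.
- by move=> *; apply: svhom_ext; apply: (triangle A).
- by move=> *; apply: svhom_ext; apply: (pentagon A).
- move=> V W U; apply: svhom_ext; apply: (@tensor_extH3 V W U).
  move=> i j k v w u hv hw hu.
  change (tassoc W U V (svswap_fun V (svten W U) (tassoc V W U (v ⊗ w ⊗ u)))
    = tmap idfun (svswap_fun V U) (tassoc W V U
        (tmap (svswap_fun V W) idfun (v ⊗ w ⊗ u)))).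
  rewrite tassocE tmapE.
  rewrite (@svswapE V (svten W U) _ _ _ _ hv (homog_tpure hw hu)).
  rewrite (svswapE hv hw) linearZl_LR !linearZ !tassocE tmapE (svswapE hv hu).
  rewrite linearZr_LR /= scalerA -signr_addb; congr ((-1) ^+ nat_of_bool _ *: _).
  by case: (i); case: (j); case: (k).
- move=> V W; apply: svhom_ext; apply: tensor_extH => i j v w hv hw.
  change (svswap_fun W V (svswap_fun V W (v ⊗ w)) = v ⊗ w).
  rewrite (svswapE hv hw) linearZ (svswapE hw hv) /= scalerA.
  by rewrite -signr_addb andbC addbb scale1r.
Qed.

Definition SVect : smCat := SMCat SVect_axioms.

End SuperVect.

Section Semisimple.
Variables (K : fieldType) (A : lmodType K) (m : A -> A -> A).
Local Open Scope classical_set_scope.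

Definition left_ideal (I : set A) : Prop :=
  [/\ I 0, forall x y, I x -> I y -> I (x + y),
      forall (c : K) x, I x -> I (c *: x) & forall x y, I y -> I (m x y)].

Definition simple_left_ideal (I : set A) : Prop :=
  [/\ left_ideal I, I <> [set 0] &
      forall J, left_ideal J -> J `<=` I -> J = [set 0] \/ J = I].

(* The left regular module is a direct sum of simple modules; the family is
   finite because the regular module of a unital algebra is generated by 1. *)
Definition semisimple_algebra : Prop :=
  exists (n : nat) (L : 'I_n -> set A),
    (forall i, simple_left_ideal (L i)) /\
    forall x, exists! y : 'I_n -> A, (forall i, L i (y i)) /\ x = \sum_i y i.

End Semisimple.

Section GradedAlgebra.
Variables (K : fieldType) (r : nat) (V : Zmod r -> lmodType K).

(* The direct sum of the V a; as Z/r is finite it is also their product. *)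
Definition dsum : Type := forall a : Zmod r, V a.

HB.instance Definition _ := gen_eqMixin dsum.
HB.instance Definition _ := gen_choiceMixin dsum.

Definition dsum_add (x y : dsum) : dsum := fun a => x a + y a.
Definition dsum_opp (x : dsum) : dsum := fun a => - x a.
Definition dsum_zero : dsum := fun a => 0.
Definition dsum_scale (c : K) (x : dsum) : dsum := fun a => c *: x a.

Fact dsum_addA : associative dsum_add.
Proof. by move=> x y z; apply: functional_extensionality_dep => a; apply: addrA. Qed.
Fact dsum_addC : commutative dsum_add.
Proof. by move=> x y; apply: functional_extensionality_dep => a; apply: addrC. Qed.
Fact dsum_add0 : left_id dsum_zero dsum_add.
Proof. by move=> x; apply: functional_extensionality_dep => a; apply: add0r. Qed.
Fact dsum_addN : left_inverse dsum_zero dsum_opp dsum_add.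
Proof. by move=> x; apply: functional_extensionality_dep => a; apply: addNr. Qed.

HB.instance Definition _ :=
  GRing.isZmodule.Build dsum dsum_addA dsum_addC dsum_add0 dsum_addN.

Fact dsum_scaleA b c x : dsum_scale b (dsum_scale c x) = dsum_scale (b * c) x.
Proof. by apply: functional_extensionality_dep => a; apply: scalerA. Qed.
Fact dsum_scale1 : left_id 1 dsum_scale.
Proof. by move=> x; apply: functional_extensionality_dep => a; apply: scale1r. Qed.
Fact dsum_scaleDr : right_distributive dsum_scale +%R.
Proof.
by move=> c x y; apply: functional_extensionality_dep => a; apply: scalerDr.
Qed.
Fact dsum_scaleDl x : {morph dsum_scale^~ x : b c / b + c}.
Proof.
by move=> b c; apply: functional_extensionality_dep => a; apply: scalerDl.
Qed.

HB.instance Definition _ := GRing.Zmodule_isLmodule.Build K dsum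
  dsum_scaleA dsum_scale1 dsum_scaleDr dsum_scaleDl.

Definition dsum_inj (a : Zmod r) (v : V a) : dsum := fun c =>
  if a =P c is ReflectT e then ecast x (V x) e v else 0.

Definition dsum_mul (m : forall a b, V a -> V b -> V (a + b - o1))
    (x y : dsum) : dsum :=
  \sum_a \sum_b dsum_inj (m a b (x a) (y b)).

End GradedAlgebra.

Section Dimension.
Variables (K : fieldType) (V : lmodType K).
Local Open Scope classical_set_scope.

Definition is_basis (S : set V) (n : nat) (e : 'I_n -> V) : Prop :=
  (forall i, S (e i)) /\
  forall x, S x -> exists! c : 'I_n -> K, x = \sum_i c i *: e i.

(* The dimension of a subspace S, with the junk value 0 if it is infinite. *)
Definition dimension (S : set V) : nat :=
  xget 0%N [set n | exists e : 'I_n -> V, is_basis S e].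

End Dimension.

Definition superdim (K : fieldType) (V : svect K) : K :=
  (dimension [set x : V | homog false x]%classic)%:R
  - (dimension [set x : V | homog true x]%classic)%:R.

Section FrobeniusVect.
Variables (K : fieldType) (r : nat).

Definition Vect_semisimple (D : closedFrobenius (Vect K) r) : Prop :=
  semisimple_algebra (@dsum_mul K r (fun a => D a : lmodType K)
    (fun a b v w => (mu D a b : {linear _ -> _}) (v ⊗ w))).

(* The value of the r-spin TQFT on the torus T(d) is the categorical dimension
   of D_d. The pairing eps o mu_{-d,d} and the copairing delta_d make
   D_d finite-dimensional, so the junk value of [dimension] does not occur. *)
Definition Vect_torus (D : closedFrobenius (Vect K) r) (d : nat) : K :=
  (dimension [set: (D (inZp d) : lmodType K)]%classic)%:R.

Definition SVect_semisimple (D : closedFrobenius (SVect K) r) : Prop :=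
  semisimple_algebra (@dsum_mul K r (fun a => (D a : svect K) : lmodType K)
    (fun a b v w => (mu D a b : svhom _ _) (v ⊗ w))).

Definition SVect_torus (D : closedFrobenius (SVect K) r) (d : nat) : K :=
  superdim (D (inZp d) : svect K).

End FrobeniusVect.

(* Main.v *)
(* Shift degrees so that D_a sits in degree a - 1: then D is a semisimple Z/r-graded
   algebra A with unit in degree 0. The even part Z of D_1 is central, and the Frobenius
   pairing puts D_(-1) in duality with D_1. Semisimplicity makes A von Neumann regular, and
   a maximality argument on the idempotents w y in Z, with w in D_(-1) and y in D_3 even,
   produces an even invertible w in D_(-1). Multiplication by w identifies D_a with D_(a-2)
   and preserves parity, so beta_d depends on d mod 2 only. An object of Vect is treated
   as a purely even super vector space. *)
Require Import Defs.
From mathcomp Require Import all_boot all_order all_algebra.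
From mathcomp Require Import boolp classical_sets.

Set Implicit Arguments.
Unset Strict Implicit.
Unset Printing Implicit Defensive.

Import GRing.Theory.

Local Open Scope ring_scope.

(** * Semisimple associative algebras: complements, regularity, invertible elements *)

Section BilinearAlgebra.
Variables (K : fieldType) (A : lmodType K) (m : {bilinear A -> A -> A}) (u : A).
Hypotheses (mA : associative m) (m1x : left_id u m) (mx1 : right_id u m).
Local Notation "x ** y" := (m x y) (at level 40, left associativity).
Local Open Scope classical_set_scope.

Definition set_sum (I J : set A) : set A :=
  [set x | exists a b, [/\ I a, J b & x = a + b]].

Lemma left_ideal_sum (I J : set A) :
  left_ideal m I -> left_ideal m J -> left_ideal m (set_sum I J).
Proof.
case=> I0 ID IZ IM [J0 JD JZ JM]; split.
- by exists 0, 0; split; rewrite ?addr0.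
- move=> _ _ [a [b [Ia Jb ->]]] [c [d [Ic Jd ->]]].
  by exists (a + c), (b + d); split; [apply: ID|apply: JD|rewrite addrACA].
- move=> k _ [a [b [Ia Jb ->]]].
  by exists (k *: a), (k *: b); split; [apply: IZ|apply: JZ|rewrite scalerDr].
- move=> x _ [a [b [Ia Jb ->]]].
  by exists (x ** a), (x ** b); split; [apply: IM|apply: JM|rewrite linearDr].
Qed.

Lemma left_ideal_cap (I J : set A) :
  left_ideal m I -> left_ideal m J -> left_ideal m (I `&` J).
Proof.
case=> I0 ID IZ IM [J0 JD JZ JM]; split=> //.
- by move=> x y [Ix Jx] [Iy Jy]; split; [apply: ID|apply: JD].
- by move=> c x [Ix Jx]; split; [apply: IZ|apply: JZ].
- by move=> x y [Iy Jy]; split; [apply: IM|apply: JM].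
Qed.

Lemma left_idealB (I : set A) x y : left_ideal m I -> I x -> I y -> I (x - y).
Proof. by case=> _ ID IZ _ Ix Iy; rewrite -scaleN1r; apply/ID/IZ. Qed.

(** The complement is built by running through the simple summands. At each stage [L j] meets
    [I + J] in [0] or in all of [L j]: in the first case [L j] is added to [J], in the second it is
    already covered. *)
Lemma semisimple_complement (I : set A) : semisimple_algebra m ->
  left_ideal m I -> exists J, [/\ left_ideal m J, I `&` J = [set 0] &
    forall x, set_sum I J x].
Proof.
case=> n [L [simL decL]] idI; have [I0 _ _ _] := idI.
have /(_ n) [J [idJ IJ0 cov]] : forall k, exists J,
    [/\ left_ideal m J, I `&` J = [set 0] &
        forall i : 'I_n, (i < k)%N -> L i `<=` set_sum I J].
  elim=> [|k [J [idJ IJ0 cov]]].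
    exists [set 0]; split=> //; last by apply/seteqP; split=> [x []|_ ->].
    by split=> [//|_ _ -> ->|c _ ->|x _ ->]; rewrite ?addr0 ?scaler0 ?linear0r.
  have [J0 _ _ _] := idJ.
  case: (ltnP k n) => [kn|nk]; last first.
    exists J; split=> // i _; apply: cov.
    exact: leq_trans (ltn_ord i) nk.
  pose j := Ordinal kn.
  have [idL L0 Lmin] := simL j.
  have idIJ := left_ideal_sum idI idJ.
  case: (Lmin _ (left_ideal_cap idL idIJ)) => [x []//|LIJ|LIJ].
    exists (set_sum J (L j)); split; first exact: left_ideal_sum.
      apply/seteqP; split=> [x [Ix [a [b [Ja Lb xE]]]]|x ->]; last first.
        by split=> //; exists 0, 0; split; rewrite ?addr0 //; case: idL.
      (* Since [x] lies in [I] and [a] in [J], the element [b = x - a] lies in both [L j] and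
         [I + J], whose intersection is [0] in this case. *)
      have b0 : b = 0.
        have : (L j `&` set_sum I J) b.
          split=> //; exists x, (- a); split=> //.
            by rewrite -sub0r; apply: left_idealB.
          by rewrite xE addrAC subrr add0r.
        by rewrite LIJ.
      have : (I `&` J) x by split=> //; rewrite xE b0 addr0.
      by rewrite IJ0.
    move=> i; rewrite ltnS leq_eqVlt => /orP[/eqP ik|/cov Li] x Lx.
      exists 0, x; split; rewrite ?add0r //; exists 0, x; split; rewrite ?add0r //.
      by have -> : j = i by apply: val_inj.
    have [a [b [Ia Jb ->]]] := Li x Lx.
    exists a, b; split=> //; exists b, 0; split; rewrite ?addr0 //.
    by case: idL.
  exists J; split=> // i; rewrite ltnS leq_eqVlt => /orP[/eqP ik|]; last exact: cov.
  have -> : i = j by apply: val_inj.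
  by rewrite -LIJ => x [].
exists J; split=> // x; have [y [[Ly ->] _]] := decL x.
have [s0 sD _ _] := left_ideal_sum idI idJ.
elim/big_ind: _ => // i _; exact: cov (Ly i).
Qed.

(* A complement [J] of [A w] splits [u = y w + j]; then [w j = w - w y w] lies in [A w] and
   in [J]. *)
Lemma semisimple_regular : semisimple_algebra m ->
  forall w, exists y, w ** y ** w = w.
Proof.
move=> ss w; pose I := [set x | exists z, x = z ** w].
have idI : left_ideal m I.
  split.
  - by exists 0; rewrite linear0l.
  - by move=> _ _ [a ->] [b ->]; exists (a + b); rewrite linearDl.
  - by move=> c _ [a ->]; exists (c *: a); rewrite linearZl_LR.
  - by move=> x _ [a ->]; exists (x ** a); rewrite mA.
have [J [idJ IJ0 cov]] := semisimple_complement ss idI.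
have [_ [j [[y ->] Jj u1]]] := cov u; have [_ _ _ JM] := idJ.
exists y; apply/esym/eqP; rewrite -subr_eq0; apply/eqP.
have wj : w - w ** y ** w = w ** j.
  by rewrite -{1}[w]mx1 u1 linearDr mA addrAC subrr add0r.
have : (I `&` J) (w - w ** y ** w).
  split; last by rewrite wj; apply: JM.
  by exists (u - w ** y); rewrite linearBl m1x.
by rewrite IJ0.
Qed.

(** Nonzero orthogonal idempotents are linearly independent, and [phi] embeds [Z] into a space of
    dimension [n]. *)
Lemma orthogonal_idempotents_bound n (phi : {linear A -> 'rV[K]_n}) (Z : set A)
    (s : nat -> A) k :
  Z 0 -> (forall x y, Z x -> Z y -> Z (x + y)) ->
  (forall c x, Z x -> Z (c *: x)) -> (forall x, Z x -> phi x = 0 -> x = 0) ->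
  (forall i, (i < k)%N -> [/\ Z (s i), s i ** s i = s i & s i != 0]) ->
  (forall i j, (i < k)%N -> (j < k)%N -> i != j -> s i ** s j = 0) ->
  (k <= n)%N.
Proof.
move=> Z0 ZD ZZ inj sk orth.
pose M := \matrix_(i < k) phi (s i).
suff /eqP <- : row_free M by apply: rank_leq_col.
rewrite -kermx_eq0; apply/eqP/row_matrixP => l; rewrite row0.
have := mulmx_ker M; move/row_matrixP/(_ l); rewrite row0 row_mul.
move: (row l _) => c cM.
have cs : \sum_i c ord0 i *: s i = 0.
  apply: inj.
    elim/big_ind: _ => // i _; apply: ZZ.
    by have [] := sk i (ltn_ord i).
  rewrite linear_sum -[RHS]cM mulmx_sum_row; apply: eq_bigr => i _ /=.
  by rewrite linearZ rowK.
apply/rowP => j; rewrite mxE.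
(* Multiplication by [s j] leaves only the [j]-th term of the relation. *)
have := congr1 (m (s j)) cs; rewrite linear0r linear_sumr (bigD1 j) //= big1.
  rewrite addr0 linearZr_LR /=; have [_ -> sj0] := sk j (ltn_ord j).
  by move/eqP; rewrite scaler_eq0 (negbTE sj0) orbF => /eqP.
move=> i ij; rewrite linearZr_LR /= orth ?scaler0 //.
by rewrite eq_sym (inj_eq val_inj).
Qed.

(* If the idempotent [F = w y] is not [u], nondegeneracy of [eps] gives [v = (u - F) e_i <> 0]
   in [T]; for [w + v] the idempotent grows by an orthogonal one, at most [n] times. *)
Lemma invertible_of_regular n (Z T T' : set A) (eps : A -> K) (e f : 'I_n -> A) :
  Z u -> (forall x y, Z x -> Z y -> Z (x - y)) -> (forall c x, Z x -> Z (c *: x)) ->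
  T 0 -> (forall x y, T x -> T y -> T (x + y)) ->
  (forall x y, Z x -> T y -> T (x ** y)) ->
  (forall x y, T x -> T' y -> Z (x ** y)) ->
  (forall x y, T x -> T' y -> Z (y ** x)) ->
  (forall x y, Z x -> x ** y = y ** x) ->
  (forall w, T w -> exists y, T' y /\ w ** y ** w = w) ->
  linear (eps : A -> K^o) -> (forall i, T (e i)) ->
  (forall x, Z x -> x = \sum_i eps (x ** e i) *: f i) ->
  exists w y, [/\ T w, T' y, w ** y = u & y ** w = u].
Proof.
move=> Zu ZB ZZ T0 TD ZT TT' T'T Zc reg epsL Te sep.
have Z0 : Z 0 by rewrite -(subrr u); apply: ZB.
have ZN x : Z x -> Z (- x) by move=> ?; rewrite -sub0r; apply: ZB.
have ZD x y : Z x -> Z y -> Z (x + y).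
  by move=> ? ?; rewrite -[y]opprK; apply: ZB => //; apply: ZN.
have phiL : linear (fun x => \row_i eps (x ** e i)).
  move=> c x y; apply/rowP => i; rewrite !mxE.
  by rewrite linearDl linearZl_LR /= epsL.
have phi0 x : Z x -> mklin phiL x = 0 -> x = 0.
  move=> Zx /rowP p0; rewrite (sep x Zx) big1 // => i _.
  by have := p0 i; rewrite !mxE => ->; rewrite scale0r.
(* [P k] asks for [k] orthogonal nonzero idempotents of [Z] that are fixed by [w y]; the bound [n]
   makes a largest such [k] exist. *)
pose P k := exists w y (s : nat -> A),
  [/\ T w, T' y, w ** y ** w = w,
   forall i, (i < k)%N ->
     [/\ Z (s i), s i ** s i = s i, s i != 0 & w ** y ** s i = s i] &
   forall i j, (i < k)%N -> (j < k)%N -> i != j -> s i ** s j = 0].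
have P0 : exists k, `[< P k >].
  exists 0%N; apply/asboolP; have [y [T'y wyw]] := reg _ T0.
  by exists 0, y, (fun=> 0); split.
have Pn k : `[< P k >] -> (k <= n)%N.
  move=> /asboolP[w [y [s [_ _ _ sP orth]]]].
  apply: (@orthogonal_idempotents_bound n (mklin phiL) Z s k) => // i /sP[].
  by split.
case: (ex_maxnP P0 Pn) => k /asboolP[w [y [s [Tw T'y wyw sP orth]]]] kmax.
set F := w ** y in wyw sP.
have ZF : Z F by apply: TT'.
have FF : F ** F = F by rewrite {2}/F mA wyw.
have [F1|F1] := eqVneq F u.
  exists w, y; split=> //.
  have Zyw : Z (y ** w) by apply: T'T.
  (* For [g = u - y w] one has [w g = 0], and [g] lies in [Z], so it commutes with [w]; hence
     [g = g (w y) = (w g) y = 0]. *)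
  have wg : w ** (u - y ** w) = 0 by rewrite linearBr mx1 mA wyw subrr.
  have Zg : Z (u - y ** w) by apply: ZB.
  apply/esym/eqP; rewrite -subr_eq0; apply/eqP; move: (u - _) wg Zg => g wg Zg.
  by rewrite -[g]mx1 -F1 /F mA (Zc _ w) // wg linear0l.
set g := u - F; have g0 : g != 0 by rewrite subr_eq0 eq_sym.
have Zg : Z g by apply: ZB.
have Fg : F ** g = 0 by rewrite linearBr mx1 FF subrr.
have [i gi] : exists i, g ** e i != 0.
  apply/existsP; apply: contraNT g0; rewrite negb_exists => /forallP h.
  rewrite (sep g Zg) big1 // => i _; have /eqP -> := negPn (h i).
  suff -> : eps 0 = 0 by rewrite scale0r.
  by have := epsL (-1) 0 0; rewrite scaler0 addr0 scaleN1r addNr.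
set v := g ** e i in gi; have Tv : T v by apply: ZT.
have Fv : F ** v = 0 by rewrite mA Fg linear0l.
have [z [T'z vzv]] := reg v Tv; set G := v ** z in vzv.
have ZG : Z G by apply: TT'.
have GG : G ** G = G by rewrite {2}/G mA vzv.
have FG : F ** G = 0 by rewrite mA Fv linear0l.
have GF : G ** F = 0 by rewrite Zc.
have G0 : G != 0.
  by apply: contraNneq gi => G0; rewrite -vzv G0 linear0l.
have Twv : T (w + v) by apply: TD.
have [y1 [T'y1 h1]] := reg _ Twv; set F1' := _ ** y1 in h1.
have ZF1 : Z F1' by apply: TT'.
(* Multiplying [F1' (w + v) = w + v] by [F], which commutes with [F1'], kills [v] and keeps [w]. *)
have F1w : F1' ** w = w.
  have := congr1 (m F) h1.
  by rewrite mA -(Zc F1') // -mA linearDr wyw Fv addr0.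
have F1v : F1' ** v = v.
  by have := h1; rewrite linearDr F1w => /addrI.
have F1F : F1' ** F = F by rewrite mA F1w.
have F1G : F1' ** G = G by rewrite mA F1v.
(* [s j = F s j] and [G F = 0] make [G] orthogonal to the old idempotents. *)
have Gs j : (j < k)%N -> G ** s j = 0 /\ s j ** G = 0.
  move=> /sP[Zs _ _ Fs]; have Gs0 : G ** s j = 0 by rewrite -Fs mA GF linear0l.
  by split=> //; rewrite Zc.
suff /asboolP /kmax : P k.+1 by rewrite ltnn.
exists (w + v), y1, (fun j => if j == k then G else s j); split=> //.
  move=> j; rewrite ltnS leq_eqVlt; case: eqVneq => //= _ /sP[? ? ? Fs].
  by split=> //; rewrite -Fs mA F1F.
move=> j l; rewrite !ltnS [(j <= k)%N]leq_eqVlt [(l <= k)%N]leq_eqVlt.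
case: eqVneq => [->|_] /=; case: eqVneq => [->|_] //=; rewrite ?eqxx //.
- by move=> _ /Gs[].
- by move=> /Gs[].
- exact: orth.
Qed.

End BilinearAlgebra.

(* A transparent name for the module, so that its structure is not inferred anew at each use. *)
Definition dsum_lmod (K : fieldType) (r : nat) (V : Zmod r -> lmodType K) :
  lmodType K := dsum V.

(** * The algebra structure on the direct sum *)

Section DirectSum.
Variables (K : fieldType) (r : nat) (V : Zmod r -> lmodType K).
Variable m : forall a b, {bilinear V a -> V b -> V (a + b - o1)}.
Local Notation A := (dsum_lmod V).
Local Notation inj a v := (@dsum_inj K r V a v).
Local Notation mul := (dsum_mul (fun a b => m a b)).

Lemma dsum_ext (x y : A) : (forall a, x a = y a) -> x = y.
Proof. exact: functional_extensionality_dep. Qed.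

Lemma dsum_sumE I (s : seq I) (P : pred I) (F : I -> A) a :
  (\sum_(i <- s | P i) F i) a = \sum_(i <- s | P i) F i a.
Proof. exact: (big_morph (fun x : A => x a)). Qed.

Lemma dsum_inj_id a (v : V a) : inj a v a = v.
Proof. by rewrite /dsum_inj; case: eqP => // e; rewrite eq_axiomK. Qed.

Lemma dsum_inj_neq a b (v : V a) : a != b -> inj a v b = 0.
Proof. by rewrite /dsum_inj; case: eqP. Qed.

Lemma dsum_inj_linear a : linear (fun v => inj a v : A).
Proof.
move=> c v w; apply: dsum_ext => b; have [<-|ab] := eqVneq a b.
  by rewrite dsum_inj_id -[RHS]/(c *: inj a v a + inj a w a) !dsum_inj_id.
rewrite -[RHS]/(c *: inj a v b + inj a w b) !dsum_inj_neq //.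
by rewrite scaler0 addr0.
Qed.

Definition dinj a : {linear V a -> A} := mklin (@dsum_inj_linear a).

Lemma dinjE a v : inj a v = dinj a v.
Proof. by []. Qed.

Lemma dinj_id a (v : V a) : dinj a v a = v.
Proof. exact: dsum_inj_id. Qed.

Lemma dinj_neq a b (v : V a) : a != b -> dinj a v b = 0.
Proof. exact: dsum_inj_neq. Qed.

Lemma dsum_sum (x : A) : x = \sum_a dinj a (x a).
Proof.
apply: dsum_ext => a; rewrite dsum_sumE (bigD1 a) //= dsum_inj_id.
by rewrite big1 ?addr0 // => b ba; rewrite dsum_inj_neq.
Qed.

Lemma dsum_mul_bilinear : bilinear_for *:%R *:%R (mul : A -> A -> A).
Proof.
split=> [x c y z|x c y z] /=; rewrite /dsum_mul scaler_sumr -big_split;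
  apply: eq_bigr => a _ /=; rewrite scaler_sumr -big_split;
  apply: eq_bigr => b _ /=.
- rewrite -[(c *: y + z) a]/(c *: y a + z a) linearPl /=.
  exact: dsum_inj_linear.
- rewrite -[(c *: y + z) b]/(c *: y b + z b) linearPr /=.
  exact: dsum_inj_linear.
Qed.

Definition dmul : {bilinear A -> A -> A} := mkbilin dsum_mul_bilinear.

Lemma dmul_inj a b (v : V a) (w : V b) :
  dmul (dinj a v) (dinj b w) = dinj _ (m a b v w).
Proof.
rewrite /= /dsum_mul (bigD1 a) //= (bigD1 b) //= !dsum_inj_id.
rewrite [X in _ + X + _]big1 => [|c cb]; last first.
  rewrite (@dsum_inj_neq b c w) 1?eq_sym // linear0r dinjE.
  exact: linear0.
rewrite addr0 big1 ?addr0 // => c ca; rewrite big1 // => d _.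
rewrite (@dsum_inj_neq a c v) 1?eq_sym // linear0l dinjE.
exact: linear0.
Qed.

Section Homogeneous.
Variable M : {bilinear A -> A -> A}.

Lemma bilinear_assoc :
  (forall a b c (x : V a) (y : V b) (z : V c),
     M (M (dinj a x) (dinj b y)) (dinj c z)
     = M (dinj a x) (M (dinj b y) (dinj c z))) ->
  associative M.
Proof.
move=> MA x y z; rewrite [x]dsum_sum [y]dsum_sum.
rewrite !(linear_sumlz M); apply: eq_bigr => a _.
rewrite !(linear_sumr M) (linear_sumlz M); apply: eq_bigr => b _.
rewrite [z]dsum_sum !(linear_sumr M); apply: eq_bigr => c _.
by rewrite MA.
Qed.

Lemma bilinear_unitl (u : A) :
  (forall a (x : V a), M u (dinj a x) = dinj a x) -> left_id u M.
Proof.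
move=> Mu x; rewrite [x]dsum_sum (linear_sumr M).
by apply: eq_bigr => a _; rewrite Mu.
Qed.

Lemma bilinear_unitr (u : A) :
  (forall a (x : V a), M (dinj a x) u = dinj a x) -> right_id u M.
Proof.
move=> Mu x; rewrite [x]dsum_sum (linear_sumlz M).
by apply: eq_bigr => a _; rewrite Mu.
Qed.

Lemma bilinear_comm (u : A) :
  (forall a (x : V a), M (dinj a x) u = M u (dinj a x)) ->
  forall x, M x u = M u x.
Proof.
move=> Mu x; rewrite [x]dsum_sum (linear_sumlz M) (linear_sumr M).
by apply: eq_bigr => a _; rewrite Mu.
Qed.

End Homogeneous.

(** The two iterated products have indices that agree only up to a propositional equality, so the
    law is compared after injection into the direct sum. *)
Lemma dmul_assoc :
  (forall a b c (x : V a) (y : V b) (z : V c),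
     dinj _ (m _ _ (m _ _ x y) z) = dinj _ (m _ _ x (m _ _ y z))) ->
  associative dmul.
Proof.
move=> mA; apply: bilinear_assoc => a b c x y z.
by rewrite (dmul_inj x y) (dmul_inj y z) !dmul_inj mA.
Qed.

Lemma dmul_unitl (u : V o1) :
  (forall a (x : V a), dinj _ (m _ _ u x) = dinj _ x) ->
  left_id (dinj _ u) dmul.
Proof.
by move=> mu1; apply: bilinear_unitl => a x; rewrite dmul_inj mu1.
Qed.

Lemma dmul_unitr (u : V o1) :
  (forall a (x : V a), dinj _ (m _ _ x u) = dinj _ x) ->
  right_id (dinj _ u) dmul.
Proof.
by move=> mu1; apply: bilinear_unitr => a x; rewrite dmul_inj mu1.
Qed.

End DirectSum.

(** * Invariance of dimension under isomorphism of subspaces *)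

Lemma is_basis_transport (K : fieldType) (V W : lmodType K) (S : set V) (T : set W)
    (f : {linear V -> W}) (g : {linear W -> V}) n (e : 'I_n -> V) :
  (forall x, S x -> T (f x)) -> (forall y, T y -> S (g y)) ->
  (forall x, S x -> g (f x) = x) -> (forall y, T y -> f (g y) = y) ->
  is_basis S e -> is_basis T (fun i => f (e i)).
Proof.
move=> fS gT gf fg [Se eP]; split=> [i|y Ty]; first exact: fS.
have [c [cE cu]] := eP _ (gT _ Ty); exists c; split.
  rewrite -(fg y Ty) cE linear_sum; apply: eq_bigr => i _; exact: linearZ.
move=> d yE; apply: cu; rewrite yE linear_sum; apply: eq_bigr => i _.
by rewrite linearZ /= gf.
Qed.

(** Bases correspond under [f] and [g], so both sides choose from the same set of sizes; if that set
    is empty, both take the default [0]. *)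
Lemma dimension_iso (K : fieldType) (V W : lmodType K) (S : set V) (T : set W)
    (f : {linear V -> W}) (g : {linear W -> V}) :
  (forall x, S x -> T (f x)) -> (forall y, T y -> S (g y)) ->
  (forall x, S x -> g (f x) = x) -> (forall y, T y -> f (g y) = y) ->
  dimension S = dimension T.
Proof.
move=> fS gT gf fg; rewrite /dimension; congr (xget _ _).
apply/seteqP; split=> n [e eP].
  exists (fun i => f (e i)); exact: is_basis_transport gf fg eP.
exists (fun i => g (e i)); exact: is_basis_transport fg gf eP.
Qed.

(** * Elements homogeneous in degree and parity, and the degree shift by two *)

Section SuperGraded.
Variables (K : fieldType) (r : nat) (V : Zmod r -> svect K).
Local Notation W := (fun a : Zmod r => V a : lmodType K).
Local Notation A := (dsum_lmod W).

Definition homog_in (a : Zmod r) (i : bool) (x : A) : Prop :=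
  exists2 v : V a, homog i v & x = dinj W a v.

Fact dsum_proj_linear a i : linear (fun x : A => dinj W a (sv_proj (V a) i (x a))).
Proof.
by move=> c x y; rewrite -linearP -linearP.
Qed.

Definition dsum_proj a i : {linear A -> A} := mklin (@dsum_proj_linear a i).

Lemma homog_in_proj a i x : homog_in a i (dsum_proj a i x).
Proof. by exists (sv_proj (V a) i (x a)) => //; apply: homog_proj. Qed.

Lemma homog_in_lin a i c x y :
  homog_in a i x -> homog_in a i y -> homog_in a i (c *: x + y).
Proof.
move=> [v hv ->] [w hw ->]; exists (c *: v + w); last by rewrite linearP.
by rewrite /homog linearP hv hw.
Qed.

Lemma homog_in0 a i : homog_in a i 0.
Proof. by exists 0; [apply: homog0|rewrite linear0]. Qed.

Lemma homog_in_comp a b i x : homog_in a i x -> a = b ->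
  homog i (x b : V b) /\ x = dinj W b (x b).
Proof. by move=> [v hv ->] <-; rewrite dinj_id. Qed.

Lemma dsum_proj_homog a b i j x : homog_in b j x ->
  dsum_proj a i x = if (a == b) && (i == j) then x else 0.
Proof.
move=> [v hv ->]; rewrite -[LHS]/(dinj W a (sv_proj (V a) i (dinj W b v a))).
have [->|ab] := eqVneq a b.
  by rewrite dinj_id (proj_homog _ hv); case: ifP; rewrite // linear0.
by rewrite dinj_neq 1?eq_sym // !linear0.
Qed.

Lemma dsum_proj_sum x : x = \sum_a \sum_i dsum_proj a i x.
Proof.
rewrite {1}[x]dsum_sum; apply: eq_bigr => a _.
by rewrite big_bool -{1}[x a]sv_projD addrC linearD.
Qed.


Variable M : {bilinear A -> A -> A}.
Hypothesis M_homog : forall a b i j (x y : A), homog_in a i x -> homog_in b j y ->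
  homog_in (a + b - o1) (i (+) j) (M x y).

Lemma homog_in_mul a b c i j x y : homog_in a i x -> homog_in b j y ->
  a + b - o1 = c -> homog_in c (i (+) j) (M x y).
Proof. by move=> hx hy <-; apply: M_homog. Qed.

(** In [w y w] the component of [y] in degree [a] lands in degree [a - 4] and keeps its parity.
    Comparison with [w], even of degree [-1], leaves only the even component of [y] in degree
    [3]. *)
Lemma homog_in_regular w y : homog_in (- o1) false w -> M (M w y) w = w ->
  M (M w (dsum_proj (o1 + o1 + o1) false y)) w = w.
Proof.
move=> hw wyw; have := congr1 (dsum_proj (- o1) false) wyw.
rewrite (dsum_proj_homog _ _ hw) !eqxx => wE; rewrite -[RHS]wE.
have proj_term a i : dsum_proj (- o1) false (M (M w (dsum_proj a i y)) w)
    = if (a == o1 + o1 + o1) && ~~ i then M (M w (dsum_proj a i y)) w else 0.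
  have h := M_homog (M_homog hw (homog_in_proj a i y)) hw.
  rewrite (dsum_proj_homog _ _ h) addbF (_ : (false == i) = ~~ i); last by case: i {h}.
  have -> // : (- o1 == - o1 + a - o1 + - o1 - o1) = (a == o1 + o1 + o1).
  have -> : - o1 + a - o1 + - o1 - o1 = - o1 + (a - (o1 + o1 + o1)) :> Zmod r.
    by rewrite !opprD !addrA.
  by rewrite -subr_eq0 opprD addrA subrr add0r oppr_eq0 subr_eq0.
rewrite {2}(dsum_proj_sum y) (linear_sumr M) (linear_sumlz M) linear_sum.
transitivity (\sum_a if a == o1 + o1 + o1
                     then M (M w (dsum_proj a false y)) w else 0).
  by rewrite -big_mkcond big_pred1_eq.
apply: eq_bigr => a _.
rewrite (linear_sumr M) (linear_sumlz M) linear_sum big_bool !proj_term.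
by rewrite andbF andbT; apply/esym; apply: add0r.
Qed.

Variables (U : A) (phi : {linear A -> K^o}).
Variables (n : nat) (e : 'I_n -> V (- o1)) (f : 'I_n -> A).
Hypotheses (MA : associative M) (M1 : left_id U M) (M2 : right_id U M)
  (hU : homog_in o1 false U)
  (M_comm : forall x y, homog_in o1 false x -> M x y = M y x)
  (phi_even : forall x, homog_in (- o1) true x -> phi x = 0)
  (phi_sep : forall x, homog_in o1 false x ->
     x = \sum_i phi (M x (dinj W _ (e i))) *: f i)
  (ss : semisimple_algebra M).

(** An instance of [invertible_of_regular], with [Z], [T] and [T'] the even parts of degrees [1],
    [-1] and [3]; in the grading with the unit in degree [0] these are the degrees [0], [-2] and
    [2]. *)
Lemma homog_in_invertible : exists w y,
  [/\ homog_in (- o1) false w, homog_in (o1 + o1 + o1) false y,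
      M w y = U & M y w = U].
Proof.
have E1 : o1 - o1 - o1 = - o1 :> Zmod r by rewrite subrr sub0r.
have E2 : - o1 + (o1 + o1 + o1) - o1 = o1 :> Zmod r.
  by rewrite addrA addrA addNr add0r addrK.
have E3 : o1 + o1 + o1 - o1 - o1 = o1 :> Zmod r by rewrite !addrK.
apply: (@invertible_of_regular K A M U MA M2 n (homog_in o1 false)
  (homog_in (- o1) false) (homog_in (o1 + o1 + o1) false) phi
  (fun i => dinj W (- o1) (sv_proj _ false (e i))) f) => //.
- by move=> x y hx hy; rewrite addrC -scaleN1r; apply: homog_in_lin.
- by move=> c x hx; rewrite -[_ *: _]addr0; apply: homog_in_lin => //; apply: homog_in0.
- exact: homog_in0.
- by move=> x y hx hy; rewrite -[x]scale1r; apply: homog_in_lin.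
- by move=> x y hx hy; apply: homog_in_mul hx hy E1.
- by move=> x y hx hy; apply: homog_in_mul hx hy E2.
- by move=> x y hx hy; apply: homog_in_mul hy hx E3.
- move=> w hw; have [y wyw] := semisimple_regular MA M1 M2 ss w.
  exists (dsum_proj (o1 + o1 + o1) false y).
  by split; [apply: homog_in_proj|apply: homog_in_regular].
- exact: linearP.
- by move=> i; exists (sv_proj _ false (e i)) => //; apply: homog_proj.
(* Only the even part of [e i] counts: the even [x] times the odd part is odd of degree [-1], where
   [phi] vanishes. *)
move=> x hx; rewrite {1}(phi_sep hx); apply: eq_bigr => i _.
congr (_ *: _); rewrite -[e i in LHS]sv_projD linearD linearDr linearD.
rewrite [X in _ + X]phi_even ?addr0 //.
rewrite -[true]/(false (+) true); apply: homog_in_mul hx _ E1.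
by exists (sv_proj _ true (e i)) => //; apply: homog_proj.
Qed.

(** Left multiplications by [w] and [y] are inverse to each other between degrees [a] and [a - 2],
    and preserve parity because both elements are even. *)
Lemma dimension_shift a i :
  dimension [set x : V a | homog i x] = dimension [set x : V (a - o1 - o1) | homog i x].
Proof.
have [w [y [hw hy wy yw]]] := homog_in_invertible.
have Ew : - o1 + a - o1 = a - o1 - o1 by rewrite [- o1 + a]addrC.
have Ey : o1 + o1 + o1 + (a - o1 - o1) - o1 = a.
  by rewrite [X in X - _]addrC !addrA !subrK addrK.
have fL : linear (fun x : V a => M w (dinj W a x) (a - o1 - o1)).
  by move=> c x z; rewrite linearP (linearPr M).
have gL : linear (fun x : V (a - o1 - o1) => M y (dinj W _ x) a).
  by move=> c x z; rewrite linearP (linearPr M).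
have hinj b (x : V b) : homog i x -> homog_in b i (dinj W b x) by exists x.
apply: (@dimension_iso K (V a) (V (a - o1 - o1)) _ _ (mklin fL) (mklin gL)).
- move=> x hx; have := homog_in_mul hw (hinj _ _ hx) Ew.
  by case/(homog_in_comp)/(_ erefl).
- move=> x hx; have := homog_in_mul hy (hinj _ _ hx) Ey.
  by case/(homog_in_comp)/(_ erefl).
(* The product [w x] is homogeneous, so by [E] nothing is lost in passing to its component of degree
   [a - 2]. *)
- move=> x hx; have h := homog_in_mul hw (hinj _ _ hx) Ew.
  have [_ E] := homog_in_comp h erefl.
  rewrite -[LHS]/(M y (dinj W _ (M w (dinj W a x) (a - o1 - o1))) a) -E.
  by rewrite MA yw M1 dinj_id.
move=> x hx; have h := homog_in_mul hy (hinj _ _ hx) Ey.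
have [_ E] := homog_in_comp h erefl.
rewrite -[LHS]/(M w (dinj W _ (M y (dinj W (a - o1 - o1) x) a)) (a - o1 - o1)) -E.
by rewrite MA wy M1 dinj_id.
Qed.

End SuperGraded.

(** * Reduction from the structure maps to the direct sum *)

Lemma graded_frobenius_shift (K : fieldType) (r : nat) (V : Zmod r -> svect K)
    (W := fun a : Zmod r => V a : lmodType K)
    (m : forall a b, {bilinear V a -> V b -> V (a + b - o1)})
    (u : V o1) (eps : {linear V (- o1) -> K^o}) :
  (forall a b i j (x : V a) (y : V b), homog i x -> homog j y ->
     homog (i (+) j) (m a b x y)) ->
  homog false u -> (forall x, homog true x -> eps x = 0) ->
  (forall a b c (x : V a) (y : V b) (z : V c),
     dinj W _ (m _ _ (m _ _ x y) z) = dinj W _ (m _ _ x (m _ _ y z))) ->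
  (forall a (x : V a), dinj W _ (m _ _ u x) = dinj W _ x) ->
  (forall a (x : V a), dinj W _ (m _ _ x u) = dinj W _ x) ->
  (forall a (x : V a) (y : V o1), homog false y ->
     dinj W _ (m _ _ x y) = dinj W _ (m _ _ y x)) ->
  (exists n (e : 'I_n -> V (- o1)) (f : 'I_n -> V o1), forall x : V o1,
     x = \sum_i eps (dinj W _ (m _ _ x (e i)) (- o1)) *: f i) ->
  semisimple_algebra (dsum_mul (V := W) (fun a b => m a b)) ->
  forall a i, dimension [set x : V a | homog i x]
    = dimension [set x : V (a - o1 - o1) | homog i x].
Proof.
move=> m_even u_even eps_even mA m1 m2 mC [n [e [f sep]]] ss.
(* [phi] extends the counit by zero to the degrees other than [-1]. *)
have phiL : linear (fun x : dsum_lmod W => eps (x (- o1)) : K^o).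
  by move=> c x y; rewrite -linearP.
pose phi := mklin phiL.
apply: (@dimension_shift K r V (@dmul K r W m) _ (dinj W o1 u) phi n e
  (fun i => dinj W o1 (f i))).
- move=> a b i j _ _ [v hv ->] [w hw ->].
  by exists (m a b v w); [apply: m_even|apply: dmul_inj].
- exact: dmul_assoc.
- exact: dmul_unitl.
- exact: dmul_unitr.
- by exists u.
- move=> x y [v hv ->]; apply/esym; move: y; apply: bilinear_comm => a z.
  by rewrite !dmul_inj mC.
- move=> _ [v hv ->]; rewrite -[LHS]/(eps (dinj W (- o1) v (- o1))).
  by rewrite dinj_id eps_even.
- move=> _ [v hv ->]; rewrite {1}(sep v) linear_sum; apply: eq_bigr => i _.
  by rewrite linearZ dmul_inj.
- exact: ss.
Qed.

Lemma tensor_sum (K : fieldType) (V W : lmodType K) (t : tensor V W) :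
  exists n (e : 'I_n -> V) (f : 'I_n -> W), t = \sum_i e i ⊗ f i.
Proof.
elim/tensor_ind: t => [|x y [n [e [f ->]]] [k [g [h ->]]]|v w].
- by exists 0%N, (fun=> 0), (fun=> 0); rewrite big_ord0.
- exists (n + k)%N.
  exists (fun i => match split i with inl j => e j | inr j => g j end).
  exists (fun i => match split i with inl j => f j | inr j => h j end).
  rewrite big_split_ord /=; congr (_ + _); apply: eq_bigr => i _.
    by rewrite (unsplitK (inl i)).
  by rewrite (unsplitK (inr i)).
by exists 1%N, (fun=> v), (fun=> w); rewrite big_ord1.
Qed.

(** Write [Dl u] as a finite sum of terms [e i ⊗ f i]. The Frobenius relation at [x ⊗ u] turns
    [Dl x] into the sum of the [mP (x ⊗ e i) ⊗ f i], and the counit law then gives a finite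
    dual-basis formula. *)
Lemma copairing_expansion (K : fieldType) (C P : lmodType K) (u : C)
    (Dl : {linear C -> tensor P C}) (mC : {linear tensor C C -> C})
    (mP : {linear tensor C P -> P}) (eps : {linear P -> K^o}) :
  (forall w, mC (w ⊗ u) = w) ->
  (forall x, tlunit C (tmap eps idfun (Dl x)) = x) ->
  (forall x, tmap idfun mC (tassoc P C C (Dl x ⊗ u))
     = tmap mP idfun (tassocV C P C (x ⊗ Dl u))) ->
  exists n (e : 'I_n -> P) (f : 'I_n -> C), forall x,
    x = \sum_i eps (mP (x ⊗ e i)) *: f i.
Proof.
move=> mu_unit counit frob; have [n [e [f DlE]]] := tensor_sum (Dl u).
exists n, e, f => x; rewrite -[LHS]counit.
(* The unit law brings [Dl x] into the form of the left side of the Frobenius relation. *)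
have -> : Dl x = tmap idfun mC (tassoc P C C (Dl x ⊗ u)).
  elim/tensor_ind: (Dl x) => [|y z hy hz|v w].
  - by rewrite linear0l !linear0.
  - by rewrite linearDl !linearD -hy -hz.
  - by rewrite tassocE tmapE mu_unit.
(* [g] bundles the composite into one linear map, which then distributes over the sum. *)
have [g gE] : exists g : {linear tensor C (tensor P C) -> C}, g =1
    (fun t => tlunit C (tmap eps idfun (tmap mP idfun (tassocV C P C t)))).
  by exists (lcomp (lcomp (tlunit C) (tmap eps idfun))
              (lcomp (tmap mP idfun) (tassocV C P C))).
rewrite frob -gE DlE (linear_sumr (@tpure K C (tensor P C))) linear_sum.
by apply: eq_bigr => i _; rewrite gE tassocVE !tmapE tlunitE.
Qed.

Fact linear_tpure_bilinear (K : fieldType) (V W U : lmodType K)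
    (f : {linear tensor V W -> U}) :
  bilinear_for *:%R *:%R (fun v w => f (v ⊗ w)).
Proof. by split=> [w c v v'|v c w w']; rewrite ?linearPl ?linearPr linearP. Qed.

Definition tbilin (K : fieldType) (V W U : lmodType K)
  (f : {linear tensor V W -> U}) := mkbilin (linear_tpure_bilinear f).

(** * Verification of the hypotheses in super vector spaces *)

Section SVectFrobenius.
Variables (K : fieldType) (r : nat) (D : closedFrobenius (SVect K) r).
Let V (a : Zmod r) : svect K := D a.
Let W (a : Zmod r) : lmodType K := V a.

(** The structure maps of [D], retyped as even linear maps so that they can be evaluated on
    elements. *)
Let smu a b : svhom (svten (V a) (V b)) (V (a + b - o1)) := mu D a b.
Let smu_to a b c (e : a + b - o1 = c) : svhom (svten (V a) (V b)) (V c) := mu_to D e.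
Let seta : svhom (svone K) (V o1) := eta D.
Let seps : svhom (V (- o1)) (svone K) := eps D.
Let sDel a b c (e : a + b + o1 = c) : svhom (V c) (svten (V a) (V b)) := Del_from D e.

Lemma dinj_smu_to a b c (e : a + b - o1 = c) t :
  dinj W c (smu_to e t) = dinj W _ (smu a b t).
Proof. by rewrite /smu_to /mu_to; case: c / e. Qed.

Lemma svswap_evenr (X Y : svect K) (x : X) (y : Y) : homog false y ->
  svswap_fun X Y (x ⊗ y) = y ⊗ x.
Proof.
move=> hy; rewrite -[x]sv_projD linearDl linearDr linearD.
by rewrite !(svswapE (homog_proj _ _) hy) !andbF !scale1r.
Qed.

Lemma SVect_dimension_shift : SVect_semisimple D -> forall a i,
  dimension [set x : V a | homog i x] = dimension [set x : V (a - o1 - o1) | homog i x].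
Proof.
move=> ss; have ax := frob_axioms D.
have h11 : o1 + o1 - o1 = o1 :> Zmod r by rewrite addrK.
have unitr a (e : a + o1 - o1 = a) (x : V a) : smu_to e (x ⊗ seta 1) = x.
  have := congr1 (fun g : svhom (svten (V a) (svone K)) (V a) =>
    g (@tpure K (V a) K^o x 1)) (mu_unitr ax e).
  rewrite -[X in X = _ -> _]/(smu_to e (tmap idfun seta (x ⊗ (1 : K^o)))).
  rewrite -[X in _ = X -> _]/(trunit (V a) (x ⊗ (1 : K^o))).
  by rewrite tmapE trunitE scale1r.
have unitl a (e : o1 + a - o1 = a) (x : V a) : smu_to e (seta 1 ⊗ x) = x.
  have := congr1 (fun g : svhom (svten (svone K) (V a)) (V a) =>
    g (@tpure K K^o (V a) 1 x)) (mu_unitl ax e).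
  rewrite -[X in X = _ -> _]/(smu_to e (tmap seta idfun ((1 : K^o) ⊗ x))).
  rewrite -[X in _ = X -> _]/(tlunit (V a) ((1 : K^o) ⊗ x)).
  by rewrite tmapE tlunitE scale1r.
apply: (@graded_frobenius_shift K r V (fun a b => tbilin (smu a b)) (seta 1) seps).
- by move=> a b i j x y hx hy; apply: (sv_even (smu a b)); apply: homog_tpure.
- by apply: (sv_even seta).
(* [seps x] is odd, and the odd part of the unit object is [0]. *)
- by move=> x hx; have := sv_even seps hx => /esym.
- move=> a b c x y z.
  have e : a + (b + c - o1) - o1 = a + b - o1 + c - o1.
    by congr (_ - _); rewrite !addrA addrAC.
  have := congr1 (fun g : svhom (svten (svten (V a) (V b)) (V c)) _ =>
    g ((x ⊗ y) ⊗ z)) (mu_assoc ax erefl erefl erefl e).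
  rewrite -[X in X = _ -> _]/(smu_to erefl (tmap (smu_to erefl) idfun ((x ⊗ y) ⊗ z))).
  rewrite -[X in _ = X -> _]/(smu_to e (tmap idfun (smu_to erefl)
    (tassoc (V a) (V b) (V c) ((x ⊗ y) ⊗ z)))).
  rewrite tassocE !tmapE => /(congr1 (dinj W _)).
  by rewrite !dinj_smu_to.
- move=> a x; have e : o1 + a - o1 = a by rewrite addrC addKr.
  by rewrite -[in RHS](unitl a e x) dinj_smu_to.
- move=> a x; have e : a + o1 - o1 = a by rewrite addrK.
  by rewrite -[in RHS](unitr a e x) dinj_smu_to.
- move=> b x y hy.
  (* At [a = o1] the exponent [o1 - a] is [0], so the power of [Nak] is the identity; since [y] is
     even, the braiding contributes no sign. *)
  have := mu_comml ax (erefl (b + o1 - o1)) (congr1 (fun c => c - o1) (addrC o1 b)).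
  rewrite (_ : nat_of_ord (o1 - o1 : Zmod r) = 0%N) ?subrr //.
  move/(congr1 (fun g : svhom (svten (V b) (V o1)) _ => g (x ⊗ y))).
  rewrite -[X in X = _ -> _]/(smu_to erefl (tmap idfun idfun (x ⊗ y))).
  rewrite -[X in _ = X -> _]/(smu_to _ (svswap_fun (V b) (V o1) (x ⊗ y))).
  rewrite tmapE svswap_evenr // => /(congr1 (dinj W _)).
  by rewrite !dinj_smu_to.
- have h1 : - o1 + o1 + o1 = o1 :> Zmod r by rewrite addNr add0r.
  have h2 : o1 - o1 - o1 = - o1 :> Zmod r by rewrite subrr sub0r.
  have [||x|n [e [f sep]]] := @copairing_expansion K (V o1) (V (- o1)) (seta 1) (sDel h1)
    (smu_to h11) (smu_to h2) seps.
  + by move=> w; apply: unitr.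
  + move=> x; have := congr1 (fun g : svhom (V o1) (V o1) => g x) (Del_counitl ax h1).
    exact.
  (* The Frobenius relation at [a = b = d = 1] and [c = -1], with the unit in the second factor;
     [sDel h1 (seta 1)] is the copairing in degrees [-1] and [1]. *)
  + have := congr1 (fun g : svhom (svten (V o1) (V o1)) (svten (V (- o1)) (V o1)) =>
      g (x ⊗ seta 1)) (mu_Del_frobenius ax h1 h11 h1 h2).
    rewrite -[X in X = _ -> _]/(tmap idfun (smu_to h11) (tassoc _ _ _
      (tmap (sDel h1) idfun (x ⊗ seta 1)))).
    rewrite -[X in _ = X -> _]/(tmap (smu_to h2) idfun (tassocV _ _ _
      (tmap idfun (sDel h1) (x ⊗ seta 1)))).
    by rewrite !tmapE.
  exists n, e, f => x; rewrite {1}(sep x); apply: eq_bigr => i _; congr (_ *: _).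
  by rewrite -(dinj_smu_to h2) dinj_id.
- exact: ss.
Qed.

End SVectFrobenius.

(** * Ordinary vector spaces as purely even super vector spaces *)

Section PurelyEven.
Variables (K : fieldType) (L : lmodType K).

Fact even_proj_linear (i : bool) : linear (fun x : L => if i then 0 else x).
Proof. by case: i => c x y //; rewrite scaler0 addr0. Qed.

Definition even_proj (i : bool) : {linear L -> L} := mklin (even_proj_linear i).

Fact even_projM i j x :
  even_proj i (even_proj j x) = if i == j then even_proj i x else 0.
Proof. by case: i; case: j. Qed.

Fact even_projD x : even_proj false x + even_proj true x = x.
Proof. exact: addr0. Qed.

Definition even_svect : svect K := SVectOb even_projM even_projD.

Lemma even_svect_homog i (x : even_svect) : homog i x <-> (i -> x = 0).
Proof.
case: i; split=> // h.
by rewrite (h isT) /homog linear0.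
Qed.

End PurelyEven.

(** * Verification of the hypotheses in ordinary vector spaces *)

Section VectFrobenius.
Variables (K : fieldType) (r : nat) (D : closedFrobenius (Vect K) r).
Let W (a : Zmod r) : lmodType K := D a.
Let V (a : Zmod r) : svect K := even_svect (W a).

Let vmu a b : {linear tensor (W a) (W b) -> W (a + b - o1)} := mu D a b.
Let vmu_to a b c (e : a + b - o1 = c) : {linear tensor (W a) (W b) -> W c} :=
  mu_to D e.
Let veta : {linear K^o -> W o1} := eta D.
Let veps : {linear W (- o1) -> K^o} := eps D.
Let vDel a b c (e : a + b + o1 = c) : {linear W c -> tensor (W a) (W b)} :=
  Del_from D e.

Lemma dinj_vmu_to a b c (e : a + b - o1 = c) t :
  dinj W c (vmu_to e t) = dinj W _ (vmu a b t).
Proof. by rewrite /vmu_to /mu_to; case: c / e. Qed.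

Lemma Vect_dimension_shift : Vect_semisimple D -> forall a,
  dimension [set: W a] = dimension [set: W (a - o1 - o1)].
Proof.
move=> ss a0; have ax := frob_axioms D.
(* All of [W a] is even, so the total dimension is that of the even part. *)
have homogT a : [set: W a]%classic = [set x : V a | homog false x]%classic.
  by apply/seteqP; split=> x //= _; apply/even_svect_homog.
rewrite !homogT.
have h11 : o1 + o1 - o1 = o1 :> Zmod r by rewrite addrK.
have unitr a (e : a + o1 - o1 = a) (x : W a) : vmu_to e (x ⊗ veta 1) = x.
  have := congr1 (fun g : {linear tensor (W a) K^o -> W a} => g (x ⊗ 1))
    (mu_unitr ax e).
  rewrite -[X in X = _ -> _]/(vmu_to e (tmap idfun veta (x ⊗ (1 : K^o)))).
  rewrite -[X in _ = X -> _]/(trunit (W a) (x ⊗ (1 : K^o))).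
  by rewrite tmapE trunitE scale1r.
have unitl a (e : o1 + a - o1 = a) (x : W a) : vmu_to e (veta 1 ⊗ x) = x.
  have := congr1 (fun g : {linear tensor K^o (W a) -> W a} => g (1 ⊗ x))
    (mu_unitl ax e).
  rewrite -[X in X = _ -> _]/(vmu_to e (tmap veta idfun ((1 : K^o) ⊗ x))).
  rewrite -[X in _ = X -> _]/(tlunit (W a) ((1 : K^o) ⊗ x)).
  by rewrite tmapE tlunitE scale1r.
apply: (@graded_frobenius_shift K r V (fun a b => tbilin (vmu a b)) (veta 1) veps).
- move=> a b i j x y /even_svect_homog hx /even_svect_homog hy.
  apply/even_svect_homog; case: i hx => [->|_] //=; first by rewrite linear0l linear0.
  by move=> /hy ->; rewrite linear0r linear0.
- exact/even_svect_homog.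
- by move=> x /even_svect_homog ->; rewrite ?linear0.
- move=> a b c x y z.
  have e : a + (b + c - o1) - o1 = a + b - o1 + c - o1.
    by congr (_ - _); rewrite !addrA addrAC.
  have := congr1 (fun g : {linear tensor (tensor (W a) (W b)) (W c) -> _} =>
    g ((x ⊗ y) ⊗ z)) (mu_assoc ax erefl erefl erefl e).
  rewrite -[X in X = _ -> _]/(vmu_to erefl (tmap (vmu_to erefl) idfun ((x ⊗ y) ⊗ z))).
  rewrite -[X in _ = X -> _]/(vmu_to e (tmap idfun (vmu_to erefl)
    (tassoc (W a) (W b) (W c) ((x ⊗ y) ⊗ z)))).
  rewrite tassocE !tmapE => /(congr1 (dinj W _)).
  by rewrite !dinj_vmu_to.
- move=> a x; have e : o1 + a - o1 = a by rewrite addrC addKr.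
  by rewrite -[in RHS](unitl a e x) dinj_vmu_to.
- move=> a x; have e : a + o1 - o1 = a by rewrite addrK.
  by rewrite -[in RHS](unitr a e x) dinj_vmu_to.
- move=> b x y _.
  (* As in the super case the exponent is [0]; the braiding is now the plain swap. *)
  have := mu_comml ax (erefl (b + o1 - o1)) (congr1 (fun c => c - o1) (addrC o1 b)).
  rewrite (_ : nat_of_ord (o1 - o1 : Zmod r) = 0%N) ?subrr //.
  move/(congr1 (fun g : {linear tensor (W b) (W o1) -> _} => g (x ⊗ y))).
  rewrite -[X in X = _ -> _]/(vmu_to erefl (tmap idfun idfun (x ⊗ y))).
  rewrite -[X in _ = X -> _]/(vmu_to _ (tswap (W b) (W o1) (x ⊗ y))).
  rewrite tmapE tswapE => /(congr1 (dinj W _)).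
  by rewrite !dinj_vmu_to.
- have h1 : - o1 + o1 + o1 = o1 :> Zmod r by rewrite addNr add0r.
  have h2 : o1 - o1 - o1 = - o1 :> Zmod r by rewrite subrr sub0r.
  have [||x|n [e [f sep]]] := @copairing_expansion K (W o1) (W (- o1)) (veta 1)
    (vDel h1) (vmu_to h11) (vmu_to h2) veps.
  + by move=> w; apply: unitr.
  + by move=> x; have := congr1 (fun g : {linear W o1 -> W o1} => g x) (Del_counitl ax h1).
  + have := congr1 (fun g : {linear tensor (W o1) (W o1) -> tensor (W (- o1)) (W o1)} =>
      g (x ⊗ veta 1)) (mu_Del_frobenius ax h1 h11 h1 h2).
    rewrite -[X in X = _ -> _]/(tmap idfun (vmu_to h11) (tassoc _ _ _
      (tmap (vDel h1) idfun (x ⊗ veta 1)))).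
    rewrite -[X in _ = X -> _]/(tmap (vmu_to h2) idfun (tassocV _ _ _
      (tmap idfun (vDel h1) (x ⊗ veta 1)))).
    by rewrite !tmapE.
  exists n, e, f => x; rewrite {1}(sep x); apply: eq_bigr => i _; congr (_ *: _).
  by rewrite -(dinj_vmu_to h2) dinj_id.
- exact: ss.
Qed.

End VectFrobenius.

(** * Counting the values of a function of period two *)

Lemma size_undup_shift2 (T : eqType) (r : nat) (F : Zmod r -> T) (s : seq nat) :
  (forall a, F a = F (a - o1 - o1)) ->
  (size (undup [seq F (inZp d) | d <- s]) <= 2)%N.
Proof.
move=> FE; have F2 d : F (inZp d.+2) = F (inZp d).
  rewrite FE; congr F; apply/eqP; rewrite !subr_eq; apply/eqP/val_inj.
  by rewrite /= modnDmr modnDml -addnA modnDml addnCA modnDml addn1.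
pose t := [:: F (inZp 0); F (inZp 1)].
rewrite (@uniq_leq_size _ _ t) ?undup_uniq // => _ /[!mem_undup] /mapP[d _ ->].
(* The induction carries two consecutive integers, since [F2] steps by two. *)
suff [h0 h1] : F (inZp d) \in t /\ F (inZp d.+1) \in t by [].
elim: d => [|d [h0 h1]]; first by rewrite !inE !eqxx orbT.
by split=> //; rewrite F2.
Qed.

Theorem corollary3p12 (K : closedFieldType) (charK : [pchar K] =i pred0)
    (r : nat) (r_ge1 : (1 <= r)%N) :
  (forall D : closedFrobenius (Vect K) r, Vect_semisimple D ->
     (size (undup [seq Vect_torus D d | d <- divisors r]) <= 2)%N) /\
  (forall D : closedFrobenius (SVect K) r, SVect_semisimple D ->
     (size (undup [seq SVect_torus D d | d <- divisors r]) <= 2)%N).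
Proof.
split=> D ss.
  apply: (size_undup_shift2 (F := fun a => (dimension [set: (D a : lmodType K)])%:R)).
  by move=> a; rewrite (Vect_dimension_shift ss).
apply: (size_undup_shift2 (F := fun a => superdim (D a : svect K))) => a.
(* The shift preserves the dimension in each parity, hence also the difference. *)
by rewrite /superdim !(SVect_dimension_shift ss a).
Qed.
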